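(* Let $p\in(0,+\infty]$ and let $K,L\subset\mathbb{R}^n$ be convex bodies with $o\in \mathrm{int}\,K\cap \mathrm{int}\,L$ such that $K^{o,p}$ and $L^{o,p}$ have opposite barycenters, i.e. $\mathrm{bar}(K^{o,p})=-\mathrm{bar}(L^{o,p})$. Then $$\binom{2n}{n}\,\Big|\mathrm{conv}\big(K^{o,p}\cup L^{o,p}\big)\Big|\cdot\Big|\Big((K^{o,p})^{o}-(L^{o,p})^{o}\Big)^{o}\Big|\ \geq\ |K^{o,p}|\,|L^{o,p}|.$$
   Context: A convex body in $\mathbb{R}^n$ is a compact convex set with non-empty interior; $o$ is the origin, $|\cdot|$ is volume, $\mathrm{conv}$ is convex hull, and $\mathrm{bar}(A)=\frac{1}{|A|}\int_A x\,dx$ is the barycenter. For sets $A,B$, $A-B=\{a-b:a\in A,b\in B\}$. The polar body of $A$ is $A^o=\{y\in\mathbb{R}^n:\langle x,y\rangle\le1\ \forall x\in A\}$. $L_p$ support function: for $p\in(0,\infty)$ and a convex body $K$, $h_{p,K}(y)=\frac1p\log\Big(\frac{1}{|K|}\int_K e^{p\langle x,y\rangle}dx\Big)$; for $p=\infty$, $h_{\infty,K}(y)=h_K(y)=\max_{x\in K}\langle x,y\rangle$. $L_p$ polar body: $K^{o,p}=\{y\in\mathbb{R}^n:\|y\|_{K^{o,p}}\le1\}$, where $\|y\|_{K^{o,p}}=\Big(\frac{1}{(n-1)!}\int_0^\infty r^{n-1}e^{-h_{p,K}(ry)}dr\Big)^{-1/n}$ (equal to $0$ if the integral is $+\infty$,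 e.g. at $y=o$); $K^{o,\infty}=K^o$. *)

(* Defs.v *)
From HB Require Import structures.
From mathcomp Require Import all_boot all_order all_algebra.
From mathcomp Require Import all_classical all_reals all_analysis.

Set Implicit Arguments.
Unset Strict Implicit.
Unset Printing Implicit Defensive.

Import Order.TTheory GRing.Theory Num.Theory.
Import numFieldNormedType.Exports.

Local Open Scope classical_set_scope.
Local Open Scope ring_scope.

(* R^n is 'rV[R]_n. Its sigma-algebra is generated by the n coordinate maps,
   as the library does for n.-tuple; it is the Borel sigma-algebra of the
   product topology of 'rV[R]_n. *)
Section measurable_rV.
Context {R : realType}.
Variable n : nat.

Let coors : 'I_n -> 'rV[R]_n -> R := fun i x => x 0 i.

Let rV_set0 : g_sigma_preimage coors set0.
Proof. exact: sigma_algebra0. Qed.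

Let rV_setC A : g_sigma_preimage coors A -> g_sigma_preimage coors (~` A).
Proof. exact: sigma_algebraC. Qed.

Let rV_bigcup (F : _^nat) : (forall i, g_sigma_preimage coors (F i)) ->
  g_sigma_preimage coors (\bigcup_i (F i)).
Proof. exact: sigma_algebra_bigcup. Qed.

HB.instance Definition _ := @isMeasurable.Build default_measure_display
  'rV[R]_n (g_sigma_preimage coors) rV_set0 rV_setC rV_bigcup.

Lemma measurable_coord (i : 'I_n) :
  measurable_fun [set: 'rV[R]_n] (fun x : 'rV[R]_n => x 0 i).
Proof.
move=> _ Y mY; rewrite setTI; apply: sub_sigma_algebra => /=.
rewrite -bigcup_seq/=; exists i => /=; first by rewrite mem_index_enum.
by exists Y => //; rewrite setTI.
Qed.

Lemma measurable_fun_coordP d (T : measurableType d) (f : T -> 'rV[R]_n) :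
  (forall i, measurable_fun [set: T] (fun t => f t 0 i)) ->
  measurable_fun [set: T] f.
Proof.
move=> mf.
suff : g_sigma_preimage (fun i t => f t 0 i) `<=` @measurable _ T.
  rewrite (_ : (fun i t => f t 0 i) = (fun i => coors i \o f))//.
  by rewrite g_sigma_preimage_comp => prefS _ A mA; apply: prefS; exists A.
apply: smallest_sub; first exact: sigma_algebra_measurable.
move=> A; rewrite -bigcup_seq/= => -[i _ [B mB <-]].
exact: mf.
Qed.

End measurable_rV.

Section lebesgue_rV.
Context {R : realType}.

Definition rV_cons n (p : measurableTypeR R * 'rV[R]_n) : 'rV[R]_n.+1 :=
  \row_i if unlift ord0 i is Some j then p.2 0 j else p.1.

Definition rV_uncons n (x : 'rV[R]_n.+1) : measurableTypeR R * 'rV[R]_n :=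
  (x 0 ord0, \row_i x 0 (lift ord0 i)).

Lemma rV_cons0 n p : @rV_cons n p 0 ord0 = p.1.
Proof. by rewrite mxE unlift_none. Qed.

Lemma rV_consS n p i : @rV_cons n p 0 (lift ord0 i) = p.2 0 i.
Proof. by rewrite mxE liftK. Qed.

Lemma rV_consK n : cancel (@rV_cons n) (@rV_uncons n).
Proof.
case=> a x; rewrite /rV_uncons rV_cons0; congr (_, _).
by apply/rowP => i; rewrite mxE rV_consS.
Qed.

Lemma measurable_rV_cons n : measurable_fun setT (@rV_cons n).
Proof.
apply: measurable_fun_coordP => i; case: (unliftP ord0 i) => [j ->|->].
  under eq_fun do rewrite rV_consS.
  exact: (measurableT_comp (measurable_coord j) measurable_snd).
under eq_fun do rewrite rV_cons0.
exact: measurable_fst.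
Qed.

Lemma measurable_rV_uncons n : measurable_fun setT (@rV_uncons n).
Proof.
apply: measurable_fun_pair; first exact: measurable_coord.
apply: measurable_fun_coordP => i; under eq_fun do rewrite mxE.
exact: measurable_coord.
Qed.

Section step.
Variables (n : nat) (mu : {sigma_finite_measure set 'rV[R]_n -> \bar R}).

Definition lebesgue_rV_step : set 'rV[R]_n.+1 -> \bar R :=
  pushforward (lebesgue_measure \x mu)%E (@rV_cons n).

Let mcons := @measurable_rV_cons n.

Let step0 : lebesgue_rV_step set0 = 0%E.
Proof. exact: measure0. Qed.

Let step_ge0 A : (0 <= lebesgue_rV_step A)%E.
Proof. exact: measure_ge0. Qed.

Let step_sigma_additive : semi_sigma_additive lebesgue_rV_step.
Proof. exact: measure_semi_sigma_additive. Qed.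

HB.instance Definition _ := isMeasure.Build _ _ _ lebesgue_rV_step
  step0 step_ge0 step_sigma_additive.

Let step_sigma_finite : sigma_finite setT lebesgue_rV_step.
Proof.
have /sigma_finiteP[F [FT ndF Foo]] := sigma_finiteT (@lebesgue_measure R).
have /sigma_finiteP[G [GT ndG Goo]] := sigma_finiteT mu.
exists (fun k => @rV_uncons n @^-1` (F k `*` G k)).
  rewrite -preimage_bigcup (_ : \bigcup_k _ = setT) ?preimage_setT//.
  rewrite -setXTT FT GT predeqE => -[x y]; split => [|].
    by move=> [k _ []/= ? ?]; split; exists k.
  move=> [/= [k _ Fkx] [l _ Gly]]; exists (maxn k l) => //; split.
    by move: x Fkx; exact/subsetPset/ndF/leq_maxl.
  by move: y Gly; exact/subsetPset/ndG/leq_maxr.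
move=> k; have [mF Fk] := Foo k; have [mG Gk] := Goo k; split.
  rewrite -[X in measurable X]setTI; apply: measurable_rV_uncons => //.
  exact: measurableX.
rewrite /lebesgue_rV_step /pushforward -comp_preimage.
rewrite (_ : _ \o _ = id); last by apply/funext => p /=; rewrite rV_consK.
by rewrite preimage_id product_measure1E// lte_mul_pinfty// ge0_fin_numE.
Qed.

HB.instance Definition _ := Measure_isSigmaFinite.Build _ _ _ lebesgue_rV_step
  step_sigma_finite.

End step.

(* n-dimensional Lebesgue measure: the n-fold product of lebesgue_measure,
   transported to row vectors. It is only used on Borel sets. *)
Fixpoint lebesgue_rV n : {sigma_finite_measure set 'rV[R]_n -> \bar R} :=
  if n is m.+1 then lebesgue_rV_step (lebesgue_rV m) else dirac (0 : 'rV[R]_0).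

Lemma lebesgue_rV_box n (A : 'I_n -> set (measurableTypeR R)) :
  (forall i, measurable (A i)) ->
  lebesgue_rV n [set x | forall i, A i (x 0 i)] =
  (\prod_(i < n) lebesgue_measure (A i))%E.
Proof.
elim: n A => [|n IHn] A mA.
  rewrite big_ord0 /= diracE mem_set//= => -[].
  by [].
rewrite big_ord_recl -IHn; last by move=> i; exact: mA.
rewrite -product_measure1E//; last first.
  rewrite [X in measurable X](_ : _ = \bigcap_(i in [set: 'I_n])
      ((fun x : 'rV[R]_n => x 0 i) @^-1` A (lift ord0 i))); last first.
    by apply/seteqP; split => x /= xA i => [_|]; exact: xA.
  apply: fin_bigcap_measurable => // i _.
  by have := measurable_coord i measurableT (mA (lift ord0 i)); rewrite setTI.
rewrite /= /lebesgue_rV_step /pushforward; congr product_measure1.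
apply/seteqP; split => -[a x] /=.
  by move=> ax; split=> [|i]; [have := ax ord0; rewrite rV_cons0
                              |have := ax (lift ord0 i); rewrite rV_consS].
by move=> [aA xA] i; case: (unliftP ord0 i) => [j ->|->];
  rewrite ?rV_consS ?rV_cons0.
Qed.

End lebesgue_rV.

Section convex_geometry.
Context {R : realType} {n : nat}.
Implicit Types (A B K : set 'rV[R]_n) (x y : 'rV[R]_n) (p : \bar R).

Local Notation vol := (lebesgue_rV n).

Definition inner x y : R := \sum_(i < n) x 0 i * y 0 i.

Definition convex_body K := [/\ compact K, convex_set K & K° !=set0].

Definition convex_hull A : set 'rV[R]_n :=
  smallest (fun B : set 'rV[R]_n => convex_set B) A.

Definition polar A : set 'rV[R]_n := [set y | forall x, A x -> inner x y <= 1].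

Definition minkowski_sub A B : set 'rV[R]_n := [set a - b | a in A & b in B].

(* Volumes are extended reals; fine is harmless here and in Lp_support, where
   they are finite and positive. *)
Definition barycenter A : 'rV[R]_n :=
  \row_i ((fine (vol A))^-1 * \int[vol]_(x in A) x 0 i).

(* Meaningful for 0 < p; the value at p = -oo is a dummy. K is meant to be
   compact and nonempty, so that the supremum is a maximum. *)
Definition Lp_support p K y : R :=
  match p with
  | q%:E => q^-1 *
      ln ((fine (vol K))^-1 * \int[vol]_(x in K) expR (q * inner x y))
  | +oo%E => sup [set inner x y | x in K]
  | -oo%E => 0
  end.

(* The integrand is nonnegative, so the default case is an integral equal to
   +oo. For n = 0 the exponent n.-1 and the factorial are meaningless. *)
Definition Lp_polar_norm p K y : R :=
  match (\int[lebesgue_measure]_(r in `[0%R, +oo[)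
           (r ^+ n.-1 * expR (- Lp_support p K (r *: y)))%:E)%E with
  | v%:E => (v / n.-1`!%:R) `^ (- n%:R^-1)
  | _ => 0
  end.

Definition Lp_polar p K : set 'rV[R]_n :=
  if p == +oo%E then polar K else [set y | Lp_polar_norm p K y <= 1].

End convex_geometry.

(* Main.v *)
Require Import Defs.
From HB Require Import structures.
From mathcomp Require Import all_boot all_order all_algebra.
From mathcomp Require Import all_classical all_reals all_analysis.
From mathcomp Require Import unstable measurable_realfun ring lra.

(* Let A = {N <= 1} and B = {M <= 1} be unit balls of gauges, and W the body
   {(x, y) | N x + M y <= 1} of R^n * R^n. By homogeneity |W| is |A| |B| times
   a Beta integral, i.e. |A| |B| / 'C(2 n, n). The fibre volume
   V u = |{x | (x, u - x) in W}| vanishes outside conv (A U B), is log-concave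
   by Prekopa-Leindler, and V 0 is at most the volume of the polar of
   polar A - polar B. Hence 1 / V is convex on {V > 0} and has a supporting
   hyperplane at 0: 1 / V 0 + <a, u> <= 1 / V u. Multiply by V and integrate
   over {V > 0}: if A and B have opposite barycenters then the linear term
   vanishes, and |W| / V 0 <= |conv (A U B)|.

   L_p polar bodies are unit balls of gauges. For p = +oo the gauge is the
   support function. For p < +oo the convexity of the unit ball is Ball's
   argument: after the substitution r = 1 / s, the reciprocal
   s^(n + 1) exp (h (y / s)) of the radial integrand is jointly convex in
   (s, y), and the one-dimensional integral inequality for harmonic means
   applies. *)

Set Implicit Arguments.
Unset Strict Implicit.
Unset Printing Implicit Defensive.

Import Order.TTheory GRing.Theory Num.Theory.
Import numFieldNormedType.Exports.

Local Open Scope classical_set_scope.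
Local Open Scope ring_scope.

(** * Lebesgue measure on row vectors *)

(** The barycenters enter through homogeneity. The integral of <a, x + y> over W splits into a part
    in x and a part in y. By dilation these are one constant c times |B| |A| <a, bar A> and c times
    |A| |B| <a, bar B>, with the same c, so they cancel for every a; the supporting hyperplane of 1
    / V at 0 may therefore have any slope. The reciprocal 1 / V is the right convex function because
    V * (1 / V) = 1 integrates to the volume of {V > 0}. A linear functional is always carried as
    its positive and negative parts, whose integrals live in [0, +oo]; a difference is taken only
    once both are known to be finite. Prekopa-Leindler and the harmonic-mean inequality are two
    instances of one statement on the line, [mean_1D], for a homogeneous mean bounded by the
    maximum. They differ in how the suprema of the two functions are eliminated at the end: by the
    inequality of the means in one case, by exact cancellation in the other. *)

(** The pushforward scaled by [c] gives half-open intervals their length, and Lebesgue measure is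
    the only measure that does. *)
Lemma lebesgue_measure_affine (R : realType) (c d : R)
    (A : set (measurableTypeR R)) : 0 < c -> measurable A ->
  (c%:E * lebesgue_measure ((fun x => c * x + d)%R @^-1` A) = lebesgue_measure A)%E.
Proof.
move=> c0 mA; apply/esym.
pose phi : measurableTypeR R -> measurableTypeR R := fun x => c * x + d.
have mphi : measurable_fun setT phi.
  by apply: measurable_funD => //; apply: measurable_realfun.measurable_funM.
pose m' : {measure set (measurableTypeR R) -> \bar R} :=
  mscale (NngNum (ltW c0))
    (measure_function_pushforward__canonical__measure_function_Measure
      (@lebesgue_measure R) mphi).
apply: (@lebesgue_measure_unique R m') => //.
move=> _ [[a b]] _ <-/=; rewrite /m' /mscale /= /pushforward.
have -> : phi @^-1` `]a, b] = `](a - d) / c, (b-d)/c]%classic.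
  apply/seteqP; split => x /=; rewrite !in_itv/= /phi.
    by move=> /andP[h1 h2]; rewrite ltr_pdivrMr// ler_pdivlMr//; apply/andP; split; lra.
  by rewrite ltr_pdivrMr// ler_pdivlMr// => /andP[h1 h2]; apply/andP; split; lra.
rewrite !lebesgue_measure_itv/= !lte_fin ltr_pM2r ?invr_gt0// ltrD2r.
case: ifP => ab; rewrite ?mule0// -?EFinB -!EFinM; congr EFin; field.
by rewrite gt_eqF.
Qed.

Lemma integral_affine (R : realType) (c d : R) (f : R -> \bar R) : 0 < c ->
  measurable_fun setT f -> (forall x, 0 <= f x)%E ->
  (c%:E * \int[@lebesgue_measure R]_x f (c * x + d)%R =
    \int[@lebesgue_measure R]_x f x)%E.
Proof.
move=> c0 mf f0.
pose phi : measurableTypeR R -> measurableTypeR R := fun x => c * x + d.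
have mphi : measurable_fun setT phi.
  by apply: measurable_funD => //; apply: measurable_realfun.measurable_funM.
pose m1 : {measure set (measurableTypeR R) -> \bar R} :=
  measure_function_pushforward__canonical__measure_function_Measure
    (@lebesgue_measure R) mphi.
pose m' : {measure set (measurableTypeR R) -> \bar R} := mscale (NngNum (ltW c0)) m1.
transitivity (\int[m']_x f x)%E; last first.
  apply: eq_measure_integral => A mA _.
  exact: (lebesgue_measure_affine d c0 mA).
rewrite ge0_integral_mscale// /m1 /=; congr (_ * _)%E.
by rewrite (ge0_integral_pushforward mphi)//.
Qed.

Lemma integral_rV_cons (R : realType) n (f : 'rV[R]_n.+1 -> \bar R) :
  measurable_fun setT f -> (forall x, 0 <= f x)%E ->
  (\int[lebesgue_rV n.+1]_x f x =
   \int[@lebesgue_measure R]_a \int[lebesgue_rV n]_x f (rV_cons (a, x)))%E.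
Proof.
move=> mf f0.
rewrite -(fubini_tonelli1 (f \o @rV_cons R n))//=; last first.
  by apply: measurableT_comp => //; exact: measurable_rV_cons.
rewrite -(ge0_integral_pushforward (@measurable_rV_cons R n) _ measurableT)//.
Qed.

Lemma measurable_integral_rV_cons (R : realType) n (f : 'rV[R]_n.+1 -> \bar R) :
  measurable_fun setT f -> (forall x, 0 <= f x)%E ->
  measurable_fun [set: R] (fun a => \int[lebesgue_rV n]_x f (rV_cons (a, x)))%E.
Proof.
move=> mf f0.
apply: (measurable_fun_fubini_tonelli_F (f \o @rV_cons R n)) => [|x]; last exact: f0.
by apply: measurableT_comp => //; exact: measurable_rV_cons.
Qed.

Lemma measurable_affine (R : realType) n (s : R) (v : 'rV[R]_n) :
  measurable_fun setT (fun x : 'rV[R]_n => s *: x + v).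
Proof.
apply: measurable_fun_coordP => i; under eq_fun do rewrite !mxE.
apply: measurable_funD => //; apply: measurable_realfun.measurable_funM => //.
exact: measurable_coord.
Qed.

Lemma measurable_rV_add (R : realType) n :
  measurable_fun setT (fun p : 'rV[R]_n * 'rV[R]_n => p.1 + p.2).
Proof.
apply: measurable_fun_coordP => i; under eq_fun do rewrite !mxE.
apply: measurable_funD; apply: (measurableT_comp (measurable_coord i)).
  exact: measurable_fst.
exact: measurable_snd.
Qed.

Lemma measurable_rV_sub (R : realType) n :
  measurable_fun setT (fun p : 'rV[R]_n * 'rV[R]_n => p.1 - p.2).
Proof.
apply: measurable_fun_coordP => i; under eq_fun do rewrite !mxE.
apply: measurable_funB; apply: (measurableT_comp (measurable_coord i)).
  exact: measurable_fst.
exact: measurable_snd.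
Qed.

Lemma integral_rV_affine (R : realType) n (s : R) (v : 'rV[R]_n)
    (f : 'rV[R]_n -> \bar R) : 0 < s ->
  measurable_fun setT f -> (forall x, 0 <= f x)%E ->
  ((s ^+ n)%:E * \int[lebesgue_rV n]_x f (s *: x + v)%R = \int[lebesgue_rV n]_x f x)%E.
Proof.
move=> s0; elim: n v f => [|n IH] v f mf f0.
  rewrite expr0 mul1e; apply: eq_integral => x _; congr (f _).
  by rewrite [LHS]thinmx0 [RHS]thinmx0.
rewrite !integral_rV_cons//; last first.
  by apply: measurableT_comp => //; exact: measurable_affine.
pose v' : 'rV[R]_n := \row_i v 0 (lift ord0 i).
have E a x : s *: rV_cons (a, x) + v = rV_cons
    (s * a + v 0 ord0, s *: x + v') :> 'rV[R]_n.+1.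
  apply/rowP => i; rewrite !mxE; case: (unliftP ord0 i) => [j ->|->].
    by rewrite !mxE.
  by [].
under eq_integral => a _ do under eq_integral => x _ do rewrite E.
rewrite exprS EFinM -muleA -ge0_integralZl//; last 3 first.
- apply: (measurable_fun_fubini_tonelli_F
  (fun p : measurableTypeR R * 'rV[R]_n =>
  f (rV_cons (s * p.1 + v 0 ord0, s *: p.2 + v')%R))) => //.
  rewrite (_ : (fun p => _) = f \o (fun x => s *: x + v) \o @rV_cons R n); last first.
    by apply/funext => -[a x] /=; rewrite E.
  apply: measurableT_comp; last exact: measurable_rV_cons.
  by apply: measurableT_comp => //; exact: measurable_affine.
- by move=> a _; apply: integral_ge0.
- by rewrite lee_fin exprn_ge0// ltW.
under eq_integral => a _.
  rewrite (IH v' (fun x => f (rV_cons (s * a + v 0 ord0, x))))//; last first.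
    apply: (measurableT_comp mf).
    apply: measurableT_comp; first exact: measurable_rV_cons.
    by apply: measurable_fun_pair.
  over.
rewrite -(integral_affine (v 0 ord0) s0)//; last by move=> a; exact: integral_ge0.
exact: measurable_integral_rV_cons.
Qed.

Lemma coord_le_norm {R : realType} {n : nat} (x : 'rV[R]_n) i : `|x 0 i| <= `|x|.
Proof.
rewrite [leRHS]/Num.norm /= mx_normrE; apply/bigmax_geP; right => /=.
by exists (ord0, i).
Qed.

Lemma norm_le_coord {R : realType} {n : nat} (x : 'rV[R]_n) (r : R) : 0 <= r ->
    (forall i, `|x 0 i| <= r) -> `|x| <= r.
Proof.
move=> r0 xr; rewrite [leLHS]/Num.norm /= mx_normrE; apply/bigmax_leP;
  split => //= -[j i] _ /=.
by rewrite (ord1 j).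
Qed.

Lemma norm_lt_coord {R : realType} {n : nat} (x : 'rV[R]_n) (r : R) : 0 < r ->
    (forall i, `|x 0 i| < r) -> `|x| < r.
Proof.
move=> r0 xr; rewrite [ltLHS]/Num.norm /= mx_normrE; apply/bigmax_ltP;
  split => //= -[j i] _ /=.
by rewrite (ord1 j).
Qed.

Lemma norm_delta_le (R : realType) n (i : 'I_n) : `|delta_mx 0 i : 'rV[R]_n| <= 1.
Proof.
by apply: norm_le_coord => // j; rewrite mxE eqxx /=; case: eqP => _;
  rewrite ?normr1 ?normr0.
Qed.

(** The sigma-algebra is generated by coordinates, so an open set is written as the countable union
    of the rational boxes that it contains. *)
Lemma open_measurable_rV {R : realType} {n : nat} (U : set 'rV[R]_n) :
    open U -> measurable U.
Proof.
move=> oU.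
pose box (p : 'rV[rat]_n * nat) : set 'rV[R]_n :=
  [set x | forall i, `|x 0 i - ratr (p.1 0 i)| < p.2.+1%:R^-1].
rewrite (_ : U = \bigcup_p (if `[< box p `<=` U >] then box p else set0)).
  apply: countable_bigcupT_measurable => //.
  move=> p; case: ifP => // _.
  rewrite (_ : box p = \bigcap_(i in [set: 'I_n])
      ((fun x : 'rV[R]_n => x 0 i) @^-1` ball (ratr (p.1 0 i) : R)
        p.2.+1%:R^-1)); last first.
    apply/seteqP; split => x /=.
      by move=> bx i _; rewrite /= -ball_normE /ball_ /= distrC; exact: bx.
    by move=> bx i; have := bx i I; rewrite /= -ball_normE /ball_ /= distrC.
  apply: fin_bigcap_measurable => // i _.
  rewrite -[X in measurable X]setTI; apply: (measurable_coord i measurableT).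
  by apply: measurable_ball.
apply/seteqP; split => x; last first.
  by move=> [p _]; case: ifPn => // /asboolP; exact.
move=> Ux; have := oU; rewrite openE => /(_ _ Ux) /nbhs_ballP[e /= e0 xeU].
have [k ke] : exists k : nat, k.+1%:R^-1 < e / 2.
  have [k _ kP] := near_infty_natSinv_lt (PosNum (divr_gt0 e0 (@ltr0Sn R 1))).
  by exists k; exact: (kP k (leqnn k)).
have [r rE] : exists r : R, r = k.+1%:R^-1 by exists k.+1%:R^-1.
have r0 : 0 < r by rewrite rE invr_gt0.
rewrite -rE in ke.
have /choice[q qP] : forall i : 'I_n, exists q : rat, `|x 0 i - ratr q| < r.
  move=> i; have /rat_in_itvoo[q] : x 0 i - r < x 0 i + r by lra.
  rewrite in_itv/= => /andP[h1 h2]; exists q; rewrite ltr_norml; apply/andP; split; lra.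
exists (\row_i q i, k) => //.
rewrite ifT; first by move=> i /=; rewrite mxE -rE.
apply/asboolP => y by_; apply: xeU; rewrite -ball_normE /ball_ /=.
apply: norm_lt_coord => // i; rewrite !mxE.
have := by_ i; have := qP i; rewrite /= mxE -rE !ltr_norml => /andP[h1 h2] /andP[h3 h4].
by apply/andP; split; lra.
Qed.

Lemma closed_measurable_rV {R : realType} {n : nat} (U : set 'rV[R]_n) :
    closed U -> measurable U.
Proof.
by move=> cU; rewrite -[U]setCK; apply: measurableC; apply:
  open_measurable_rV; exact: closed_openC.
Qed.

Lemma continuous_measurable_rV {R : realType} {n : nat} (f : 'rV[R]_n -> R) :
  continuous f -> measurable_fun [set: 'rV[R]_n] f.
Proof.
move=> cf; apply: (measurability _ (RGenOInfty.measurableE R)) => //.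
move=> /= _ [_ [a ->] <-]; rewrite setTI; apply: open_measurable_rV.
by apply: open_comp => //; exact: interval_open.
Qed.

Lemma integral_mono (d : measure_display) (T : measurableType d) (R : realType)
    (mu : {measure set T -> \bar R}) (f g : T -> \bar R) :
  (forall x, 0 <= f x)%E -> (forall x, f x <= g x)%E ->
  (\int[mu]_x f x <= \int[mu]_x g x)%E.
Proof.
move=> f0 fg.
have g0 x : (0 <= g x)%E by exact: le_trans (fg x).
rewrite !ge0_integralTE//.
apply: le_ereal_sup => _ [h hf <-]; exists h => // x; exact: le_trans (fg x).
Qed.

(* Measurability is not needed, as the integral of arbitrary nonnegative
   functions is monotone; hence convex hulls and polars need not be Borel. *)
Lemma lebesgue_rV_mono {R : realType} n (A B : set 'rV[R]_n) :
  A `<=` B -> (lebesgue_rV n A <= lebesgue_rV n B)%E.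
Proof.
elim: n A B => [|n IH] A B AB /=.
  rewrite !diracE lee_fin ler_nat; have [/set_mem A0|//] := boolP (_ \in A).
  by rewrite mem_set//; exact: AB.
rewrite /lebesgue_rV_step /pushforward /product_measure1.
apply: integral_mono => // x; apply: IH => y /=.
by rewrite /xsection /= !inE; exact: AB.
Qed.

(** * The Prekopa-Leindler inequality *)

(** For compact sets, two translates inside [S] overlap in at most one point; inner regularity gives
    the general case. *)
Lemma brunn_minkowski_1D (R : realType) (A B S : set (measurableTypeR R)) :
  measurable A -> measurable B -> measurable S -> A !=set0 -> B !=set0 ->
  (forall a b, A a -> B b -> S (a + b : R)) ->
  (lebesgue_measure A + lebesgue_measure B <= lebesgue_measure S)%E.
Proof.
move=> mA mB mS [a0 Aa0] [b0 Bb0] ABS.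
have trans (C : set (measurableTypeR R)) c : measurable C ->
    lebesgue_measure ((fun x => 1 * x + c)%R @^-1` C) = lebesgue_measure C.
  by move=> mC; rewrite -(lebesgue_measure_affine c ltr01 mC) mul1e.
have mtrans (C : set (measurableTypeR R)) c : measurable C ->
    measurable ((fun x => 1 * x + c)%R @^-1` C).
  move=> mC; rewrite -[X in measurable X]setTI.
  have : measurable_fun [set: R] (fun x : R => 1 * x + c).
    by apply: measurable_funD => //; apply: measurable_funM.
  exact.
have cpt (K L : set R) : compact K -> compact L -> K a0 -> L b0 -> K `<=` A -> L `<=` B ->
    (lebesgue_measure K + lebesgue_measure L <= lebesgue_measure S)%E.
  move=> cK cL Ka Lb KA LB.
  have [a /set_mem Ka' amax] : exists2 a, a \in K & forall t, t \in K -> t <= a.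
    apply: (@compact_EVT_max _ _ id) => //; first by exists a0.
    by apply: continuous_subspaceT => x; exact: cvg_id.
  have [b /set_mem Lb' bmin] : exists2 b, b \in L & forall t, t \in L -> - t <= - b.
    apply: (@compact_EVT_max _ _ (-%R)) => //; first by exists b0.
    by apply: continuous_subspaceT => x; exact: opp_continuous.
  have mK : measurable (K : set (measurableTypeR R)).
    exact: compact_measurable.
  have mL : measurable (L : set (measurableTypeR R)).
    exact: compact_measurable.
  (* With [a] the maximum of [K] and [b] the minimum of [L], these are K + b and L + a. The first
     lies to the left of a + b and the second to the right. *)
  pose K1 := (fun x => 1 * x + - b)%R @^-1` K : set (measurableTypeR R).
  pose L1 := (fun x => 1 * x + - a)%R @^-1` L : set (measurableTypeR R).
  rewrite -(trans _ (- b) mK) -(trans _ (- a) mL) -/K1 -/L1.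
  have mK1 : measurable K1 by exact: mtrans.
  have mL1 : measurable L1 by exact: mtrans.
  have -> : lebesgue_measure L1 = lebesgue_measure (L1 `\ (a + b)).
    rewrite (measureDI _ mL1 (measurable_set1 (a + b : R)))
      [X in (_ + X)%E](_ : _ = 0%E) ?adde0//.
    apply/eqP; rewrite -measure_le0 -(lebesgue_measure_set1 (a + b)).
    by apply: le_measure; rewrite ?inE//; exact: measurableI.
  have mL1' : measurable (L1 `\ (a + b)) by exact: measurableD.
  rewrite -measureU//.
  - apply: le_measure; rewrite ?inE//; first exact: (measurableU _ _ mK1 mL1').
    move=> x [].
    + by rewrite /K1 /= => Kx; have := ABS _ _ (KA _ Kx) (LB _ Lb'); rewrite mul1r subrK.
    + by rewrite /L1 /= => -[Lx _]; have := ABS _ _ (KA _ Ka') (LB _ Lx);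
      rewrite mul1r addrC subrK.
  - apply/seteqP; split => // x [] /=; rewrite /K1 /L1 /= => Kx [Lx xab].
    apply: xab; have := amax _ (mem_set Kx); have := bmin _ (mem_set Lx).
    by move=> h1 h2; apply/eqP; rewrite eq_le; apply/andP; split; lra.
(* Compact sets from inner regularity may be empty; adjoining [a0] and [b0] makes the previous case
   apply. *)
have cpt' (K L : set R) : compact K -> compact L -> K `<=` A -> L `<=` B ->
    (lebesgue_measure K + lebesgue_measure L <= lebesgue_measure S)%E.
  move=> cK cL KA LB.
  apply: le_trans (cpt (K `|` [set a0]) (L `|` [set b0]) _ _ _ _ _ _).
  - by apply: leeD; apply: le_measure; rewrite ?inE//;
    try (by apply: measurableU => //; exact: compact_measurable);
    exact: compact_measurable.
  - by apply: compactU => //; exact: compact_set1.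
  - by apply: compactU => //; exact: compact_set1.
  - by right.
  - by right.
  - by move=> x [/KA//|->].
  - by move=> x [/LB//|->].
have [->|Sfin] := eqVneq (lebesgue_measure S) +oo%E; first exact: leey.
have {}Sfin : lebesgue_measure S \is a fin_num by rewrite ge0_fin_numE// ltey.
have AS : (lebesgue_measure A <= lebesgue_measure S)%E.
  rewrite (lebesgue_regularity_inner_sup mA); apply: ge_ereal_sup => _ [K [cK KA] <-].
  by have := cpt' K set0 cK (@compact0 _) KA (@sub0set _ _); rewrite measure0 adde0.
have Afin : lebesgue_measure A \is a fin_num.
  by rewrite ge0_fin_numE// (le_lt_trans AS)// -ge0_fin_numE.
rewrite addeC -leeBrDr// (lebesgue_regularity_inner_sup mB).
apply: ge_ereal_sup => _ [L [cL LB] <-].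
have Lfin : lebesgue_measure L \is a fin_num.
  by rewrite ge0_fin_numE//; exact: compact_finite_measure.
rewrite leeBrDr// addeC -leeBrDr// (lebesgue_regularity_inner_sup mA).
apply: ge_ereal_sup => _ [K [cK KA] <-].
by rewrite leeBrDr//; exact: cpt'.
Qed.

Lemma measurable_ge_pair d (T : measurableType d) (R : realType) (f : T -> R) :
  measurable_fun setT f ->
  measurable [set p : T * measurableTypeR R | p.2 <= f p.1].
Proof.
move=> mf.
have mg : measurable_fun [set: T * measurableTypeR R]
    (fun p : T * measurableTypeR R => f p.1 - p.2 : R).
  apply: measurable_funB; first exact: (measurableT_comp mf).
  exact: measurable_snd.
rewrite (_ : [set p | _] = (fun p : T * measurableTypeR R =>
  f p.1 - p.2) @^-1` `[0, +oo[).
  rewrite -[X in measurable X]setTI; apply: mg => //.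
by apply/seteqP; split => p /=; rewrite in_itv/= andbT subr_ge0.
Qed.

(** Tonelli on the region under the graph. The level 1 is left out because [level_sum] has points
    above a level only when it is below 1. *)
Lemma layer_cake01 (R : realType) (f : R -> R) : measurable_fun setT f ->
    (forall x, 0 <= f x <= 1) ->
  (\int[@lebesgue_measure R]_x (f x)%:E =
   \int[@lebesgue_measure R]_(s in `]0%R,
     1%R[) lebesgue_measure [set x | (s <= f x)%R])%E.
Proof.
move=> mf f01.
pose D : set (measurableTypeR R * measurableTypeR R) :=
    [set p | p.2 <= f p.1] `&` (setT `*` `]0, 1[).
have mD : measurable D.
  by apply: measurableI; [exact: measurable_ge_pair | apply: measurableX].
have := indic_fubini_tonelli (@lebesgue_measure R) (@lebesgue_measure R) mD.
rewrite indic_fubini_tonelli_FE// indic_fubini_tonelli_GE//.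
set I1 := integral _ _ _ => I12.
transitivity I1.
  apply: eq_integral => x _ /=.
  rewrite (_ : xsection D x = if f x == 1 then `]0%R,
    1%R[%classic else `]0, f x]%classic).
    have /andP[f0 f1] := f01 x.
    case: eqVneq => [->|fx1]; rewrite lebesgue_measure_itv/= lte_fin ?ltr01 ?sube0//.
    by move: f0; rewrite le_eqVlt => /predU1P[<-|->]//; rewrite ltxx.
  apply/seteqP; split => s; rewrite /xsection/D/= inE/= in_itv/=;
    have /andP[f0 f1] := f01 x.
    move=> [sf [_ /andP[s0 s1]]]; case: eqVneq => fx /=; rewrite in_itv/= s0//=.
  case: eqVneq => [->|fx] /=; rewrite in_itv/= => /andP[-> h].
    by split => //; exact: ltW.
  by split => //; split=> //; rewrite (le_lt_trans h)// lt_neqAle fx.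
rewrite I12 [RHS]integral_mkcond; apply: eq_integral => s _ /=.
rewrite patchE; case: ifPn => [|/negP s01].
  rewrite inE/= in_itv/= => s01; congr (lebesgue_measure _).
  by apply/seteqP; split => x; rewrite /ysection/D/= inE/= in_itv/= => //; case.
rewrite (_ : ysection _ _ = set0) ?measure0//.
apply/seteqP; split => x //; rewrite /ysection/D/= inE/= in_itv/= => -[_ [_ h]].
by apply: s01; rewrite inE/= in_itv.
Qed.

(** At each level the dilated superlevel sets of [f] and [g] add up inside that of [h];
    Brunn-Minkowski is then integrated over the levels. *)
Lemma level_sum (R : realType) (lam mu : R) (f g h : R -> R) : 0 < lam -> 0 < mu ->
  measurable_fun setT f -> measurable_fun setT g -> measurable_fun setT h ->
  (forall x, 0 <= f x <= 1) -> (forall x, 0 <= g x <= 1) -> (forall x, 0 <= h x) ->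
  (forall s, s < 1 -> exists x, s <= f x) -> (forall s, s < 1 -> exists x, s <= g x) ->
  (forall s x y, 0 < s < 1 -> s <= f x -> s <= g y -> s <= h (lam * x + mu * y)) ->
  (lam%:E * \int[@lebesgue_measure R]_x (f x)%:E +
    mu%:E * \int[@lebesgue_measure R]_x (g x)%:E
    <= \int[@lebesgue_measure R]_x (h x)%:E)%E.
Proof.
move=> lam0 mu0 mf mg mh f01 g01 h0 fs gs H.
(* Only levels below 1 are compared, so [h] may be capped at 1, which makes the layer-cake formula
   available. *)
pose k x := Num.min (h x) 1.
have mk : measurable_fun setT k by apply: measurable_minr.
have k01 x : 0 <= k x <= 1.
  by rewrite /k le_min h0 ler01/= ge_min lexx orbT.
apply: (@le_trans _ _ (\int[@lebesgue_measure R]_x (k x)%:E)%E); last first.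
  by apply: integral_mono => x; rewrite lee_fin ?ge_min ?lexx//; case/andP: (k01 x).
have mS (F : R -> R) : measurable_fun setT F -> forall s,
    measurable ([set x | s <= F x] : set (measurableTypeR R)).
  move=> mF s; rewrite (_ : [set x | _] = F @^-1` `[s, +oo[).
    by rewrite -[X in measurable X]setTI; apply: mF.
  by apply/seteqP; split => x /=; rewrite in_itv/= andbT.
have mL (F : R -> R) : measurable_fun setT F ->
    measurable_fun setT (fun s : R => lebesgue_measure
      ([set x | s <= F x] : set (measurableTypeR R))).
  move=> mF; have := measurable_fun_ysection (@lebesgue_measure R)
    (measurable_ge_pair mF).
  apply: eq_measurable_fun => s _; rewrite /ysection /=; congr lebesgue_measure.
  by apply/seteqP; split => x /=; rewrite inE.
rewrite !layer_cake01// -!ge0_integralZl//; try exact: ltW;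
  try (by apply: measurable_funTS; exact: mL).
rewrite -ge0_integralD//; try (by move=> x _; rewrite mule_ge0// lee_fin ltW);
  try (by apply: measurable_funTS; apply: measurable_funeM; exact: mL).
apply: ge0_le_integral => //.
- by move=> s _; rewrite adde_ge0// mule_ge0// lee_fin ltW.
- by apply: emeasurable_funD; apply: measurable_funTS; apply: measurable_funeM; exact: mL.
- by apply: measurable_funTS; exact: mL.
move=> s /=; rewrite in_itv/= => /andP[s0 s1].
have [x0 fx0] := fs _ s1; have [y0 gy0] := gs _ s1.
(* [A] and [B] are the dilates of the superlevel sets by [lam] and [mu], written as preimages. *)
pose A := (fun x => lam^-1 * x + 0)%R @^-1` [set x | s <= f x] : set (measurableTypeR R).
pose B := (fun x => mu^-1 * x + 0)%R @^-1` [set x | s <= g x] : set (measurableTypeR R).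
have mA : measurable A.
  rewrite /A -[X in measurable X]setTI.
  have : measurable_fun [set: R] (fun x : R => lam^-1 * x + 0).
    by apply: measurable_funD => //; apply: measurable_funM.
  by apply => //; exact: mS.
have mB : measurable B.
  rewrite /B -[X in measurable X]setTI.
  have : measurable_fun [set: R] (fun x : R => mu^-1 * x + 0).
    by apply: measurable_funD => //; apply: measurable_funM.
  by apply => //; exact: mS.
have -> : (lam%:E * lebesgue_measure [set x | (s <= f x)%R] = lebesgue_measure A)%E.
  rewrite -(@lebesgue_measure_affine R lam^-1 0 _ _ (mS _ mf s)) ?invr_gt0//.
  by rewrite muleA -EFinM divff ?gt_eqF// mul1e.
have -> : (mu%:E * lebesgue_measure [set x | (s <= g x)%R] = lebesgue_measure B)%E.
  rewrite -(@lebesgue_measure_affine R mu^-1 0 _ _ (mS _ mg s)) ?invr_gt0//.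
  by rewrite muleA -EFinM divff ?gt_eqF// mul1e.
apply: brunn_minkowski_1D => //.
- by exact: mS.
- by exists (lam * x0); rewrite /A /= mulKf ?gt_eqF// addr0.
- by exists (mu * y0); rewrite /B /= mulKf ?gt_eqF// addr0.
move=> a b; rewrite /A /B /= !addr0 => fa gb.
rewrite /k le_min (ltW s1) andbT.
have := H s _ _ _ fa gb; rewrite s0 s1 => /(_ isT).
by rewrite !mulVKf ?gt_eqF.
Qed.

Definition etrunc (R : realType) (k : nat) (x : \bar R) : R := fine (mine x k%:R%:E).

Lemma etrunc_ge0 (R : realType) k (x : \bar R) : (0 <= x)%E -> 0 <= etrunc k x.
Proof. by move=> x0; rewrite fine_ge0// le_min x0 lee_fin /=. Qed.

Lemma EFin_etrunc (R : realType) k (x : \bar R) : (0 <= x)%E ->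
    (etrunc k x)%:E = mine x k%:R%:E.
Proof.
move=> x0; rewrite /etrunc fineK// ge0_fin_numE; last by rewrite le_min x0 lee_fin /=.
by rewrite (@le_lt_trans _ _ k%:R%:E)// ?ltry// ge_min lexx orbT.
Qed.

Lemma etrunc_le (R : realType) k (x : \bar R) : (0 <= x)%E -> etrunc k x <= k%:R.
Proof. by move=> x0; rewrite -lee_fin EFin_etrunc// ge_min lexx orbT. Qed.

Lemma measurable_etrunc d (T : measurableType d) (R : realType) k (f : T -> \bar R) :
  measurable_fun setT f -> measurable_fun setT (fun x => etrunc k (f x)).
Proof.
move=> mf; apply: (measurableT_comp (fine_measurable measurableT)).
by apply: measurable_mine.
Qed.

Lemma etrunc_integral_gt d (T : measurableType d) (R : realType)
    (m : {measure set T -> \bar R})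
    (f : T -> \bar R) (A : R) :
  measurable_fun setT f -> (forall x, 0 <= f x)%E -> (A%:E < \int[m]_x f x)%E ->
  exists k, (A%:E < \int[m]_x (etrunc k (f x))%:E)%E.
Proof.
move=> mf f0 Af; apply: contrapT => /forallNP H.
suff : (\int[m]_x f x <= A%:E)%E by rewrite leNgt Af.
have -> : (\int[m]_x f x = \int[m]_x limn (fun k => (etrunc k (f x))%:E))%E.
  apply: eq_integral => x _; apply/esym/cvg_lim => //.
  under eq_fun do rewrite EFin_etrunc//.
  have := f0 x; case: (f x) => [r r0| _ |//].
    apply: cvg_near_cst.
    near=> k; apply/min_idPl; rewrite lee_fin.
    by near: k; exact: nbhs_infty_ger.
  rewrite (_ : (fun _ => _) = (fun k : nat => k%:R%:E));
    first by apply/cvgeryP; exact: cvgr_idn.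
  by apply/funext => k; rewrite min_r// leey.
rewrite monotone_convergence//.
- apply: lime_le.
    apply: ereal_nondecreasing_is_cvgn => k l kl.
    by apply: integral_mono => x; rewrite ?lee_fin ?etrunc_ge0//
      -lee_fin !EFin_etrunc// le_min2 // lee_fin ler_nat.
  by apply: nearW => k; rewrite leNgt; apply/negP; exact: H.
- by move=> k; apply/measurable_EFinP; exact: measurable_etrunc.
- by move=> k x _; rewrite lee_fin etrunc_ge0.
- by move=> x _ k l kl; rewrite !EFin_etrunc// le_min2 // lee_fin ler_nat.
Unshelve. all: by end_near. Qed.

(** [a] is the supremum of [f]; the strict lower bound on the integral is what makes it positive. *)
Lemma sup_normalize (R : realType) (f : R -> R) (A K : R) : measurable_fun setT f ->
  (forall x, 0 <= f x <= K) -> 0 <= A -> (A%:E <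
    \int[@lebesgue_measure R]_x (f x)%:E)%E ->
  exists a, [/\ 0 < a, forall x, 0 <= f x / a <= 1 & forall s, s < 1 ->
    exists x, s <= f x / a].
Proof.
move=> mf f0K A0 Af.
have hs : has_sup (range f).
  by split; [exists (f 0), 0|exists K => _ [x _ <-]; case/andP: (f0K x)].
have fs x : f x <= sup (range f) by apply: ub_le_sup; [exact: hs.2|exists x].
have s0 : 0 < sup (range f).
  rewrite lt_neqAle (le_trans _ (fs 0)) ?andbT; last by case/andP: (f0K 0).
  apply/eqP => s0; move: Af; rewrite integral0_eq ?lte_fin ?ltNge ?A0// => x _.
  by congr EFin; apply/eqP; rewrite eq_le {1}s0 fs/=; case/andP: (f0K x).
exists (sup (range f)); split => // [x|s s1].
  by rewrite ler_pdivrMr// mul1r fs andbT divr_ge0//; [case/andP: (f0K x)|exact: ltW].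
have [_ [x _ <-] xs] : exists2 y, range f y & sup (range f) - (1 - s) * sup (range f) < y.
  by apply: sup_adherent => //; rewrite mulr_gt0// subr_gt0.
by exists x; rewrite ler_pdivlMr// ltW// (le_lt_trans _ xs)//; lra.
Qed.

(* Truncating [f] and [g] and dividing by their suprema [a] and [b] makes all
   superlevel sets below height 1 nonempty, so that Brunn-Minkowski applies to
   each of them; [h] is then divided by [m a b]. *)
Lemma mean_1D (R : realType) (m : R -> R -> R) (lam mu : R) (f g h : R -> \bar R) :
  0 < lam -> 0 < mu ->
  (forall u v, 0 < u -> 0 < v -> 0 < m u v) ->
  (forall s u v, 0 < s -> 0 < u -> 0 < v -> m (s * u) (s * v) = s * m u v) ->
  (forall u v, 0 < u -> 0 < v -> m u v <= Num.max u v) ->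
  measurable_fun setT f -> measurable_fun setT g -> measurable_fun setT h ->
  (forall x, 0 <= f x)%E -> (forall x, 0 <= g x)%E -> (forall x, 0 <= h x)%E ->
  (forall x y u v, 0 < u -> 0 < v -> (u%:E <= f x)%E -> (v%:E <= g y)%E ->
    ((m u v)%:E <= h (lam * x + mu * y)%R)%E) ->
  forall A B, 0 < A -> 0 < B ->
  (A%:E < \int[@lebesgue_measure R]_x f x)%E ->
    (B%:E < \int[@lebesgue_measure R]_x g x)%E ->
  exists a b, [/\ 0 < a, 0 < b &
    ((m a b * (lam * A / a + mu * B / b))%:E <= \int[@lebesgue_measure R]_x h x)%E].
Proof.
move=> lam0 mu0 m0 mZ mmax mf mg mh f0 g0 h0 H A B A0 B0.
move=> /(@etrunc_integral_gt _ _ _ (@lebesgue_measure R) f A mf f0)[k Ak].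
move=> /(@etrunc_integral_gt _ _ _ (@lebesgue_measure R) g B mg g0)[l Bl].
have tr N (F : R -> \bar R) x : (forall x, 0 <= F x)%E -> 0 <= etrunc N (F x) <= N%:R.
  by move=> F0; rewrite etrunc_ge0// etrunc_le.
have [a [a0 fa1 fas]] := sup_normalize (measurable_etrunc k mf)
    (fun x => tr k f x f0) (ltW A0) Ak.
have [b [b0 gb1 gbs]] := sup_normalize (measurable_etrunc l mg)
    (fun x => tr l g x g0) (ltW B0) Bl.
exists a, b; split => //.
(* A mean of two truncated values is at most their maximum, hence at most [N]: truncating [h] there
   keeps the pointwise hypothesis. *)
pose N := maxn k l; have mab := m0 _ _ a0 b0.
have trdiv n (F : R -> \bar R) c : measurable_fun setT F ->
    measurable_fun setT (fun x => etrunc n (F x) / c).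
  by move=> mF; apply: measurable_funM => //; exact: measurable_etrunc.
have := @level_sum R lam mu _ _ (fun x => etrunc N (h x) / m a b) lam0 mu0
    (trdiv k f a mf) (trdiv l g b mg)
  (trdiv N h (m a b) mh) fa1 gb1 _ fas gbs.
have intdiv n (F : R -> \bar R) c : 0 < c -> measurable_fun setT F ->
    (forall x, 0 <= F x)%E ->
    (\int[@lebesgue_measure R]_x (etrunc n (F x) / c)%:E =
     (c^-1)%:E * \int[@lebesgue_measure R]_x (etrunc n (F x))%:E)%E.
  move=> c0 mF F0; rewrite -ge0_integralZl//.
  - by apply: eq_integral => x _; rewrite -EFinM mulrC.
  - by apply/measurable_EFinP; exact: measurable_etrunc.
  - by move=> x _; rewrite lee_fin etrunc_ge0.
  - by rewrite lee_fin invr_ge0 ltW.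
rewrite !intdiv// => /(_ _ _)/= LS.
have {}LS : (lam%:E * ((a^-1)%:E * \int[lebesgue_measure]_x (etrunc k (f x))%:E) +
       mu%:E * ((b^-1)%:E * \int[lebesgue_measure]_x (etrunc l (g x))%:E) <=
       ((m a b)^-1)%:E * \int[lebesgue_measure]_x (etrunc N (h x))%:E)%E.
  apply: LS.
    by move=> x; rewrite divr_ge0 ?etrunc_ge0// ltW.
  move=> s x y /andP[s0 s1]; rewrite !ler_pdivlMr// => sx sy.
  rewrite -mZ// -lee_fin EFin_etrunc// le_min; apply/andP; split.
    apply: H; rewrite ?mulr_gt0//.
      by apply: (@le_trans _ _ (etrunc k (f x))%:E); rewrite ?lee_fin//
        EFin_etrunc// ge_min lexx.
    by apply: (@le_trans _ _ (etrunc l (g y))%:E); rewrite ?lee_fin//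
      EFin_etrunc// ge_min lexx.
  rewrite lee_fin (le_trans (mmax _ _ _ _)) ?mulr_gt0// ge_max.
  rewrite (le_trans sx) ?(le_trans sy)//.
    by rewrite (le_trans (etrunc_le _ _))// ler_nat leq_maxr.
  by rewrite (le_trans (etrunc_le _ _))// ler_nat leq_maxl.
have -> : (m a b * (lam * A / a + mu * B / b))%:E =
    ((m a b)%:E * (lam%:E * ((a^-1)%:E * A%:E) + mu%:E * ((b^-1)%:E * B%:E)))%E.
  by rewrite -(mulrA lam) -(mulrA mu) (mulrC A) (mulrC B) EFinM EFinD !EFinM.
rewrite muleC -lee_pdivlMr// [leRHS]muleC.
apply: (@le_trans _ _ (((m a b)^-1)%:E * \int[lebesgue_measure]_x (etrunc N (h x))%:E)%E).
  apply: le_trans LS; apply: leeD; apply: lee_wpmul2l;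
    rewrite ?lee_fin ?(ltW lam0) ?(ltW mu0)//;
    by apply: lee_wpmul2l; rewrite ?lee_fin ?invr_ge0 ltW.
apply: lee_wpmul2l; first by rewrite lee_fin invr_ge0 ltW.
apply: integral_mono => x; rewrite ?lee_fin ?etrunc_ge0// EFin_etrunc//.
by rewrite ge_min lexx.
Qed.

(** Average the tangent inequality exp c * (1 + (x - c)) <= exp x at the mean [c], where the linear
    terms cancel. *)
Lemma expR_jensen (R : realType) (lam mu a b : R) : 0 <= lam -> 0 <= mu -> lam + mu = 1 ->
  expR (lam * a + mu * b) <= lam * expR a + mu * expR b.
Proof.
move=> lam0 mu0 lm; set c := lam * a + mu * b.
have tangent x : expR c * (1 + (x - c)) <= expR x.
  have -> : expR x = expR c * expR (x - c) by rewrite -expRD addrC subrK.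
  by rewrite ler_wpM2l ?expR_ge0// expR_ge1Dx.
apply: (@le_trans _ _ (lam * (expR c * (1 + (a - c))) + mu * (expR c * (1 + (b - c))))).
  rewrite le_eqVlt; apply/orP; left; apply/eqP.
  transitivity (expR c * (lam + mu + (lam * a + mu * b) - (lam + mu) * c)); last by ring.
  by rewrite lm -/c; ring.
by rewrite lerD// ler_wpM2l.
Qed.

Definition gmean (R : realType) (lam mu u v : R) : R := expR (lam * ln u + mu * ln v).

Lemma gmean_gt0 (R : realType) (lam mu u v : R) : 0 < gmean lam mu u v.
Proof. exact: expR_gt0. Qed.

Lemma gmeanM (R : realType) (lam mu s t u v : R) : 0 < s -> 0 < t -> 0 < u -> 0 < v ->
  gmean lam mu (s * u) (t * v) = gmean lam mu s t * gmean lam mu u v.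
Proof.
move=> s0 t0 u0 v0; rewrite /gmean -expRD !lnM ?posrE//; congr expR; ring.
Qed.

Lemma gmean_diag (R : realType) (lam mu s : R) : lam + mu = 1 -> 0 < s ->
    gmean lam mu s s = s.
Proof. by move=> lm s0; rewrite /gmean -mulrDl lm mul1r lnK ?posrE. Qed.

Lemma gmeanZ (R : realType) (lam mu s u v : R) : lam + mu = 1 ->
    0 < s -> 0 < u -> 0 < v ->
  gmean lam mu (s * u) (s * v) = s * gmean lam mu u v.
Proof. by move=> lm s0 u0 v0; rewrite gmeanM// gmean_diag. Qed.

Lemma gmean_le_amean (R : realType) (lam mu u v : R) : 0 <= lam -> 0 <= mu ->
    lam + mu = 1 -> 0 < u -> 0 < v ->
  gmean lam mu u v <= lam * u + mu * v.
Proof.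
move=> lam0 mu0 lm u0 v0; apply: le_trans (expR_jensen _ _ lam0 mu0 lm) _.
by rewrite !lnK ?posrE.
Qed.

Lemma gmean_le_max (R : realType) (lam mu u v : R) : 0 <= lam -> 0 <= mu ->
    lam + mu = 1 -> 0 < u -> 0 < v ->
  gmean lam mu u v <= Num.max u v.
Proof.
move=> lam0 mu0 lm u0 v0; apply: le_trans (gmean_le_amean lam0 mu0 lm u0 v0) _.
apply: (@le_trans _ _ (lam * Num.max u v + mu * Num.max u v));
  last by rewrite -mulrDl lm mul1r.
by rewrite lerD// ler_wpM2l// le_max lexx ?orbT.
Qed.

(** Hypothesis and conclusion use positive real thresholds below the values, so that no geometric
    mean of 0 and +oo has to be given a meaning. The same form lets the statement be iterated over
    coordinates. *)
Lemma prekopa_leindler_1D (R : realType) (lam mu : R) (f g h : R -> \bar R) :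
  0 < lam -> 0 < mu -> lam + mu = 1 ->
  measurable_fun setT f -> measurable_fun setT g -> measurable_fun setT h ->
  (forall x, 0 <= f x)%E -> (forall x, 0 <= g x)%E -> (forall x, 0 <= h x)%E ->
  (forall x y u v, 0 < u -> 0 < v -> (u%:E <= f x)%E -> (v%:E <= g y)%E ->
    ((gmean lam mu u v)%:E <= h (lam * x + mu * y)%R)%E) ->
  forall u v, 0 < u -> 0 < v ->
  (u%:E <= \int[@lebesgue_measure R]_x f x)%E ->
    (v%:E <= \int[@lebesgue_measure R]_x g x)%E ->
  ((gmean lam mu u v)%:E <= \int[@lebesgue_measure R]_x h x)%E.
Proof.
move=> lam0 mu0 lm mf mg mh f0 g0 h0 H u v u0 v0 uf vg.
(* [mean_1D] asks for strict bounds on the integrals: shrink the thresholds by r < 1. *)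
apply/lee_mul01Pr; first by rewrite lee_fin ltW// gmean_gt0.
move=> r /andP[r0 r1].
have ru : ((r * u)%:E < \int[@lebesgue_measure R]_x f x)%E.
  by apply: lt_le_trans uf; rewrite lte_fin gtr_pMl.
have rv : ((r * v)%:E < \int[@lebesgue_measure R]_x g x)%E.
  by apply: lt_le_trans vg; rewrite lte_fin gtr_pMl.
have [a [b [a0 b0]]] := mean_1D lam0 mu0 (fun u v _ _ => gmean_gt0 lam mu u v)
  (fun s u v => @gmeanZ _ lam mu s u v lm)
    (fun u v => @gmean_le_max _ lam mu u v (ltW lam0) (ltW mu0) lm)
  mf mg mh f0 g0 h0 H (mulr_gt0 r0 u0) (mulr_gt0 r0 v0) ru rv.
apply: le_trans; rewrite -EFinM lee_fin -gmeanZ//.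
(* The suprema [a] and [b] are not known; multiplicativity splits them off and the
   arithmetic-geometric inequality handles the quotients. *)
have -> : gmean lam mu (r * u) (r * v) = gmean lam mu a b * gmean lam mu
    ((r * u) / a) ((r * v) / b).
  by rewrite -gmeanM ?divr_gt0 ?mulr_gt0// (mulrC a) (mulrC b) !divfK ?gt_eqF.
rewrite ler_wpM2l ?(ltW (gmean_gt0 _ _ _ _))// -!(mulrA lam) -!(mulrA mu).
by apply: gmean_le_amean; rewrite ?(ltW lam0) ?(ltW mu0) ?divr_gt0 ?mulr_gt0.
Qed.

(** [mean_1D] for the harmonic mean. With a common threshold [c] the factor lam / a + mu / b appears
    with its inverse, so the suprema [a] and [b] cancel. *)
Lemma harmonic_1D (R : realType) (lam mu : R) (f g h : R -> \bar R) :
  0 < lam -> 0 < mu -> lam + mu = 1 ->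
  measurable_fun setT f -> measurable_fun setT g -> measurable_fun setT h ->
  (forall x, 0 <= f x)%E -> (forall x, 0 <= g x)%E -> (forall x, 0 <= h x)%E ->
  (forall x y u v, 0 < u -> 0 < v -> (u%:E <= f x)%E -> (v%:E <= g y)%E ->
    (((lam / u + mu / v)^-1)%:E <= h (lam * x + mu * y)%R)%E) ->
  forall c, 0 < c ->
  (c%:E <= \int[@lebesgue_measure R]_x f x)%E ->
    (c%:E <= \int[@lebesgue_measure R]_x g x)%E ->
  (c%:E <= \int[@lebesgue_measure R]_x h x)%E.
Proof.
move=> lam0 mu0 lm mf mg mh f0 g0 h0 H c c0 cf cg.
apply/lee_mul01Pr; first by rewrite lee_fin ltW.
move=> r /andP[r0 r1].
have ru : ((r * c)%:E < \int[@lebesgue_measure R]_x f x)%E.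
  by apply: lt_le_trans cf; rewrite lte_fin gtr_pMl.
have rv : ((r * c)%:E < \int[@lebesgue_measure R]_x g x)%E.
  by apply: lt_le_trans cg; rewrite lte_fin gtr_pMl.
have pos u v : 0 < u -> 0 < v -> 0 < lam / u + mu / v.
  by move=> u0 v0; rewrite addr_gt0// divr_gt0.
have [|||a [b [a0 b0]]] := mean_1D (m := fun u v => (lam / u + mu / v)^-1) lam0 mu0 _ _ _
  mf mg mh f0 g0 h0 H (mulr_gt0 r0 c0) (mulr_gt0 r0 c0) ru rv.
- by move=> u v u0 v0; rewrite invr_gt0 pos.
- by move=> s u v s0 u0 v0; rewrite !invfM !(mulrCA _ s^-1) -mulrDr invfM invrK.
- move=> u v u0 v0; have mx0 : 0 < Num.max u v by rewrite lt_max u0.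
  rewrite -[leRHS]invrK lef_pV2 ?posrE ?invr_gt0 ?pos//.
  rewrite -[leLHS]mul1r -lm mulrDl lerD// ler_wpM2l ?(ltW lam0) ?(ltW mu0)//;
  by rewrite lef_pV2 ?posrE// le_max lexx ?orbT.
apply: le_trans; rewrite -EFinM lee_fin.
have -> : lam * (r * c) / a + mu * (r * c) / b = (lam / a + mu / b) * (r * c) by ring.
by rewrite mulKf// gt_eqF// pos.
Qed.

Lemma rV_consD (R : realType) n (lam mu : R) a b (x y : 'rV[R]_n) :
  rV_cons (lam * a + mu * b, lam *: x + mu *: y) = lam *: rV_cons (a, x) +
    mu *: rV_cons (b, y).
Proof.
apply/rowP => i; case: (unliftP ord0 i) => [j ->|->].
  by rewrite [RHS]mxE [X in _ = X + _]mxE [X in _ = _ + X]mxE !rV_consS !mxE.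
by rewrite [RHS]mxE [X in _ = X + _]mxE [X in _ = _ + X]mxE !rV_cons0.
Qed.

(** The conclusion for slices in dimension n is the pointwise hypothesis of the one-dimensional
    inequality for the slice integrals. *)
Lemma prekopa_leindler (R : realType) n (lam mu : R) (f g h : 'rV[R]_n -> \bar R) :
  0 < lam -> 0 < mu -> lam + mu = 1 ->
  measurable_fun setT f -> measurable_fun setT g -> measurable_fun setT h ->
  (forall x, 0 <= f x)%E -> (forall x, 0 <= g x)%E -> (forall x, 0 <= h x)%E ->
  (forall x y u v, 0 < u -> 0 < v -> (u%:E <= f x)%E -> (v%:E <= g y)%E ->
    ((gmean lam mu u v)%:E <= h (lam *: x + mu *: y)%R)%E) ->
  forall u v, 0 < u -> 0 < v ->
  (u%:E <= \int[lebesgue_rV n]_x f x)%E -> (v%:E <= \int[lebesgue_rV n]_x g x)%E ->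
  ((gmean lam mu u v)%:E <= \int[lebesgue_rV n]_x h x)%E.
Proof.
move=> lam0 mu0 lm; elim: n f g h => [|n IH] f g h mf mg mh f0 g0 h0 H u v u0 v0.
  rewrite /= !integral_dirac// diracT !mul1e => uf vg.
  by have := H _ _ _ _ u0 v0 uf vg; rewrite !scaler0 addr0.
rewrite (integral_rV_cons mf f0) (integral_rV_cons mg g0) (integral_rV_cons mh h0).
have mc (F : 'rV[R]_n.+1 -> \bar R) a : measurable_fun setT F ->
    measurable_fun setT (fun x => F (rV_cons (a, x))).
  move=> mF; apply: (measurableT_comp mF).
  by apply: measurableT_comp; [exact: measurable_rV_cons | exact: measurable_fun_pair].
apply: prekopa_leindler_1D => //; try (exact: measurable_integral_rV_cons);
  try by move=> a; exact: integral_ge0.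
move=> a b s t s0 t0; apply: IH => //; try exact: mc.
by move=> x y s' t' s0' t0' fx gy; rewrite rV_consD; exact: H.
Qed.

(** * Supporting hyperplanes of convex functions *)

(* The Hahn-Banach extension step from [V] to [V + R e]. *)
Lemma hyperplane_step (R : realType) n (D V : set 'rV[R]_n)
    (psi : 'rV[R]_n -> R) (e : 'rV[R]_n) (d : R) :
  0 < d -> D (d *: e) -> D (- d *: e) ->
  V 0 -> (forall x y lam mu, V x -> V y -> V (lam *: x + mu *: y)) ->
  (forall x y lam mu, D x -> D y -> 0 < lam -> 0 < mu -> lam + mu = 1 ->
    D (lam *: x + mu *: y) /\ psi (lam *: x + mu *: y) <= lam * psi x + mu * psi y) ->
  (forall w, V w -> D w -> 0 <= psi w) ->
  exists b, forall w r, V w -> D (w + r *: e) -> b * r <= psi (w + r *: e).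
Proof.
move=> d0 Dd DNd V0 Vlin conv pos.
(* Slopes forced from the side of negative multiples of [e]. By [key] none exceeds a slope allowed
   on the positive side, so the supremum of [S] serves both. *)
pose S := [set x | exists w s, [/\ V w, 0 < s, D (w + (- s) *: e) & x =
    - psi (w + (- s) *: e) / s]].
have key w r x : V w -> 0 < r -> D (w + r *: e) -> S x -> x <= psi (w + r *: e) / r.
  move=> Vw r0 Dw [w' [s [Vw' s0 Dw' ->]]].
  have rs : 0 < r + s by rewrite addr_gt0.
  have rs1 : r / (r + s) + s / (r + s) = 1 by rewrite -mulrDl divff// gt_eqF.
  have [] := conv _ _ _ _ Dw' Dw (divr_gt0 r0 rs) (divr_gt0 s0 rs) rs1.
  (* These weights cancel the [e] component, so the combination lies in [V], where [psi] is
     nonnegative. *)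
  have -> : (r / (r + s)) *: (w' + - s *: e) + (s / (r + s)) *: (w + r *: e) =
      (r / (r + s)) *: w' + (s / (r + s)) *: w.
    apply/rowP => i; rewrite !mxE; ring.
  move=> Dz; have := pos _ (Vlin _ _ _ _ Vw' Vw) Dz; move=> /le_trans /[apply].
  rewrite (_ : _ + _ = (r * psi (w' + - s *: e) + s * psi (w + r *: e)) /
    (r + s)); last by ring.
  rewrite pmulr_lge0 ?invr_gt0// => h.
  by rewrite ler_pdivrMr// mulrAC ler_pdivlMr//; lra.
have Sne : S !=set0 by exists (- psi (0 + - d *: e) / d), 0, d; rewrite add0r.
have hS : has_sup S.
  by split => //; exists (psi (0 + d *: e) / d) => x; apply: key => //; rewrite add0r.
exists (sup S) => w r Vw Dw; case: (ltgtP r 0) => r0.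
- have r0' : 0 < - r by rewrite oppr_gt0.
  have : - psi (w + r *: e) / (- r) <= sup S.
    apply: ub_le_sup; first exact: hS.2.
    by exists w, (- r); rewrite opprK.
  rewrite ler_pdivrMr// => h; lra.
- rewrite -ler_pdivlMr//; apply: ge_sup => // x Sx; exact: key.
- by move: Dw; rewrite r0 mulr0 scale0r addr0 => Dw; exact: pos.
Qed.

Lemma innerDl (R : realType) n (x y z : 'rV[R]_n) : inner (x + y) z =
    inner x z + inner y z.
Proof. by rewrite /inner -big_split; apply: eq_bigr => i _; rewrite mxE mulrDl. Qed.

Lemma innerZl (R : realType) n c (x y : 'rV[R]_n) : inner (c *: x) y = c * inner x y.
Proof. by rewrite /inner mulr_sumr; apply: eq_bigr => i _; rewrite mxE mulrA. Qed.

Lemma innerC (R : realType) n (x y : 'rV[R]_n) : inner x y = inner y x.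
Proof. by apply: eq_bigr => i _; rewrite mulrC. Qed.

Lemma innerDr (R : realType) n (x y z : 'rV[R]_n) : inner z (x + y) =
    inner z x + inner z y.
Proof. by rewrite innerC innerDl !(innerC z). Qed.

Lemma innerZr (R : realType) n c (x y : 'rV[R]_n) : inner x (c *: y) = c * inner x y.
Proof. by rewrite innerC innerZl innerC. Qed.

Lemma inner_delta (R : realType) n (x : 'rV[R]_n) i : inner (delta_mx 0 i) x = x 0 i.
Proof.
rewrite /inner (bigD1 i)//= mxE !eqxx mul1r big1 ?addr0// => j /negPf ji.
by rewrite mxE ji andbF mul0r.
Qed.

(** Hahn-Banach one coordinate at a time: stage [k] supports [phi] on the vectors whose coordinates
    from [k] on vanish. The ball inside [D] supplies a point on either side of 0 in each new
    direction. *)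
Lemma supporting_hyperplane (R : realType) n (D : set 'rV[R]_n)
    (phi : 'rV[R]_n -> R) (d : R) :
  0 < d -> (forall x, `|x| <= d -> D x) ->
  (forall x y lam mu, D x -> D y -> 0 < lam -> 0 < mu -> lam + mu = 1 ->
    D (lam *: x + mu *: y) /\ phi (lam *: x + mu *: y) <= lam * phi x + mu * phi y) ->
  exists a, forall x, D x -> phi 0 + inner a x <= phi x.
Proof.
move=> d0 dD conv.
suff /(_ n (leqnn n))[a Ha] : forall k, (k <= n)%N -> exists a, forall x, D x ->
    (forall i : 'I_n, (k <= i)%N -> x 0 i = 0) -> phi 0 + inner a x <= phi x.
  by exists a => x Dx; apply: Ha => // i; rewrite leqNgt ltn_ord.
elim=> [_|k IH kn].
  exists 0 => x Dx x0; have -> : x = 0 by apply/rowP => i; rewrite x0// mxE.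
  by rewrite -(scale0r (0 : 'rV[R]_n)) innerZl mul0r addr0.
have [a Ha] := IH (ltnW kn).
pose i0 := Ordinal kn; pose e : 'rV[R]_n := delta_mx 0 i0.
have ne : `|e| <= 1 by exact: norm_delta_le.
have [||||||b Hb] := @hyperplane_step R n D
    [set x | forall i : 'I_n, (k <= i)%N -> x 0 i = 0]
  (fun x => phi x - phi 0 - inner a x) e d d0.
- by apply: dD; rewrite normrZ gtr0_norm// -[leRHS]mulr1 ler_pM2l.
- by apply: dD; rewrite normrZ normrN gtr0_norm// -[leRHS]mulr1 ler_pM2l.
- by move=> i _; rewrite mxE.
- by move=> x y lam mu /= x0 y0 i ki; rewrite !mxE x0// y0// !mulr0 addr0.
- move=> x y lam mu Dx Dy lam0 mu0 lm; have [Dz Hz] := conv _ _ _ _ Dx Dy lam0 mu0 lm.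
  split => //; rewrite innerDr !innerZr.
  have : phi 0 = lam * phi 0 + mu * phi 0 by rewrite -mulrDl lm mul1r.
  by rewrite !mulrBr; lra.
- by move=> w /= w0 Dw; have := Ha _ Dw w0; lra.
exists (a + b *: e) => x Dx x0.
pose w := x - x 0 i0 *: e.
have xE : x = w + x 0 i0 *: e by rewrite subrK.
have := Hb w (x 0 i0); rewrite -xE => /(_ _ Dx) h.
rewrite innerDl innerZl inner_delta; suff : b * x 0 i0 <=
  phi x - phi 0 - inner a x by lra.
apply: h => i /=; rewrite !mxE eqxx /= leq_eqVlt => /predU1P[ki|ki].
  have -> : i = i0 by apply/val_inj.
  by rewrite eqxx mulr1 subrr.
rewrite x0// (_ : (i == i0) = false) ?mulr0 ?subrr//.
by apply/negbTE; rewrite -val_eqE /= gtn_eqF.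
Qed.

(** * The inequality for unit balls of gauges *)

(** A possibly asymmetric norm. The two comparisons with the norm say that the unit ball is bounded
    and has 0 in its interior. *)
Definition gauge (R : realType) n (N : 'rV[R]_n -> R) := [/\
  forall t x, 0 <= t -> N (t *: x) = t * N x,
  forall x y, N (x + y) <= N x + N y,
  exists2 c, 0 < c & forall x, c * `|x| <= N x &
  exists C, forall x, N x <= C * `|x|].

Definition ind_le (R : realType) (x y : R) : R := (x <= y)%R%:R.

Lemma ind_le_ge0 (R : realType) (x y : R) : 0 <= ind_le x y.
Proof. exact: ler0n. Qed.

Lemma measurable_ind_le d (T : measurableType d) (R : realType) (f g : T -> R) :
  measurable_fun setT f -> measurable_fun setT g ->
    measurable_fun setT (fun t => ind_le (f t) (g t)).
Proof.
move=> mf mg; rewrite (_ : (fun t => _) =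
  \1_((fun t => g t - f t) @^-1` `[0, +oo[) :> (T -> R)).
  apply: measurable_indic; rewrite -[X in measurable X]setTI.
  by apply: (measurable_funB mg mf) => //; exact: measurable_itv.
apply/funext => t; rewrite indicE /ind_le; congr (_ _)%:R; apply/idP/idP.
  by move=> fg; rewrite inE /= in_itv /= andbT subr_ge0.
by rewrite inE /= in_itv /= andbT subr_ge0.
Qed.

Lemma integral_ind_le d (T : measurableType d) (R : realType)
    (m : {measure set T -> \bar R}) (f g : T -> R) :
  measurable_fun setT f -> measurable_fun setT g ->
  (\int[m]_t (ind_le (f t) (g t))%:E = m [set t | (f t <= g t)%R])%E.
Proof.
move=> mf mg; set E := [set t | _].
have mE : measurable E.
  rewrite (_ : E = (fun t => g t - f t) @^-1` `[0, +oo[).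
    by rewrite -[X in measurable X]setTI; apply: (measurable_funB mg mf) => //;
      exact: measurable_itv.
  by apply/seteqP; split => t; rewrite /E /= in_itv /= andbT subr_ge0.
rewrite -[m E]mul1e -[X in (_ = _ * m X)%E]setIT -integral_indic// mul1e.
apply: eq_integral => t _; congr EFin; rewrite indicE /ind_le; congr (_ _)%:R.
by apply/idP/idP; rewrite inE.
Qed.

Lemma lebesgue_rV_cube (R : realType) n (r : R) : 0 <= r ->
  lebesgue_rV n [set x | `|x| <= r] = ((2 * r) ^+ n)%:E.
Proof.
move=> r0; rewrite (_ : [set x | _] = [set x : 'rV[R]_n | forall i : 'I_n,
  `[- r, r]%classic (x 0 i)]).
  rewrite (@lebesgue_rV_box R n (fun=> `[- r, r]%classic))//.
  have -> : lebesgue_measure (`[- r, r]%classic : set (measurableTypeR R)) = (2 * r)%:E.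
    rewrite lebesgue_measure_itv/= lte_fin; case: ltP => rr;
      first by rewrite -EFinD; congr EFin; ring.
    by congr EFin; lra.
  by elim: n => [|n IH]; rewrite ?big_ord0// big_ord_recl IH -EFinM exprS.
apply/seteqP; split => x /= xr.
  by move=> i; rewrite in_itv/= -ler_norml; exact: le_trans (coord_le_norm x i) xr.
by apply: norm_le_coord => // i; have := xr i; rewrite /= in_itv/= ler_norml.
Qed.

Lemma gauge0 (R : realType) n (N : 'rV[R]_n -> R) : gauge N -> N 0 = 0.
Proof. by case=> NZ _ _ _; rewrite -(scale0r (0 : 'rV[R]_n)) NZ ?mul0r. Qed.

Lemma gauge_ge0 (R : realType) n (N : 'rV[R]_n -> R) x : gauge N -> 0 <= N x.
Proof. by case=> _ _ [c c0 cN] _; apply: le_trans (cN x); rewrite mulr_ge0// ltW. Qed.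

Lemma gauge_eq0 (R : realType) n (N : 'rV[R]_n -> R) x : gauge N -> N x = 0 -> x = 0.
Proof.
case=> _ _ [c c0 cN] _ Nx0; apply/normr0_eq0/eqP.
by rewrite eq_le normr_ge0 andbT -(pmulr_rle0 _ c0) (le_trans (cN x))// Nx0.
Qed.

Lemma gauge_continuous (R : realType) n (N : 'rV[R]_n -> R) : gauge N -> continuous N.
Proof.
move=> [_ NS _ [C NC]] x; pose C' := Num.max C 1.
have C0 : 0 < C' by rewrite lt_max ltr01 orbT.
apply: (proj2 (@cvgrPdist_lt _ _ _ (nbhs x) _ N (N x))) => e e0.
have : \forall y \near x, `|x - y| < e / C'.
  apply/nbhs_ballP; exists (e / C'); first by rewrite /= divr_gt0.
  by move=> y; rewrite -ball_normE.
apply: (@filterS _ (nbhs x) _) => y yx.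
have NC' z : N z <= C' * `|z|.
  by apply: le_trans (NC z) _; rewrite ler_wpM2r// le_max lexx.
have h : C' * `|x - y| < e by rewrite mulrC -ltr_pdivlMr.
have := NS (x - y) y; have := NS (y - x) x; rewrite !subrK.
have := NC' (x - y); have := NC' (y - x); rewrite -(distrC x y) => h1 h2 h3 h4.
by rewrite ltr_norml; apply/andP; split; lra.
Qed.

Lemma measurable_gauge (R : realType) n (N : 'rV[R]_n -> R) : gauge N ->
    measurable_fun setT N.
Proof. by move=> gN; apply: continuous_measurable_rV; exact: gauge_continuous. Qed.

Lemma measurable_gauge_ball (R : realType) n (N : 'rV[R]_n -> R) : gauge N ->
    measurable [set x | N x <= 1].
Proof.
move=> gN; rewrite (_ : [set x | _] = N @^-1` `]-oo, 1]).
  by rewrite -[X in measurable X]setTI; apply: (measurable_gauge gN).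
by apply/seteqP; split => x; rewrite /= in_itv.
Qed.

Lemma gauge_ball_bounded (R : realType) n (N : 'rV[R]_n -> R) : gauge N ->
  exists2 r, 0 <= r & forall x, N x <= 1 -> `|x| <= r.
Proof.
case=> _ _ [c c0 cN] _; exists c^-1; first by rewrite invr_ge0 ltW.
by move=> x Nx; rewrite -[leRHS]mul1r ler_pdivlMr// mulrC (le_trans (cN x)).
Qed.

Lemma gauge_ball_small (R : realType) n (N : 'rV[R]_n -> R) : gauge N ->
  forall e, 0 < e -> exists2 r, 0 < r & forall x, `|x| <= r -> N x <= e.
Proof.
case=> _ _ _ [C NC] e e0; pose C' := Num.max C 1.
have C0 : 0 < C' by rewrite lt_max ltr01 orbT.
exists (e / C'); first exact: divr_gt0.
move=> x; rewrite ler_pdivlMr// => h; apply: le_trans (NC x) _.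
by apply: le_trans h; rewrite mulrC ler_wpM2l// le_max lexx.
Qed.

Lemma gauge_ball_fin (R : realType) n (N : 'rV[R]_n -> R) : gauge N ->
  lebesgue_rV n [set x | N x <= 1] \is a fin_num.
Proof.
move=> gN; have [r r0 Nr] := gauge_ball_bounded gN.
rewrite ge0_fin_numE// (@le_lt_trans _ _ (lebesgue_rV n [set x | `|x| <= r]))//.
  exact: lebesgue_rV_mono.
by rewrite lebesgue_rV_cube// ltry.
Qed.

Lemma gauge_ball_gt0 (R : realType) n (N : 'rV[R]_n -> R) : gauge N ->
  (0 < lebesgue_rV n [set x | (N x <= 1)%R])%E.
Proof.
move=> gN; have [r r0 Nr] := gauge_ball_small gN ltr01.
apply: (@lt_le_trans _ _ (lebesgue_rV n [set x | `|x| <= r])).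
  by rewrite lebesgue_rV_cube ?ltW// lte_fin exprn_gt0// mulr_gt0.
exact: lebesgue_rV_mono.
Qed.

(** Dilation by [s] yields s^n from the measure and s^k from [g]. The degree is k = 0 for volumes
    and k = 1 for first moments. *)
Lemma integral_gauge_dilate (R : realType) n (N : 'rV[R]_n -> R) (k : nat)
    (g : 'rV[R]_n -> \bar R) (s : R) :
  gauge N -> measurable_fun setT g -> (forall x, 0 <= g x)%E ->
  (forall t x, 0 < t -> g (t *: x) = ((t ^+ k)%:E * g x)%E) -> 0 < s ->
  (\int[lebesgue_rV n]_x (g x * (ind_le (N x) s)%:E) =
   (s ^+ (n + k))%:E * \int[lebesgue_rV n]_x (g x * (ind_le (N x) 1)%:E))%E.
Proof.
move=> gN mg g0 gZ s0.
have mi r : measurable_fun setT (fun x => g x * (ind_le (N x) r)%:E)%E.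
  apply: emeasurable_funM => //; apply/measurable_EFinP.
  by apply: measurable_ind_le; [exact: measurable_gauge|exact: measurable_cst].
have i0 r x : (0 <= g x * (ind_le (N x) r)%:E)%E by rewrite mule_ge0// lee_fin ind_le_ge0.
rewrite -(@integral_rV_affine R n s 0 _ s0)// exprD EFinM -muleA; congr (_ * _)%E.
rewrite -ge0_integralZl//; last by rewrite lee_fin exprn_ge0// ltW.
apply: eq_integral => x _; rewrite addr0 gZ// -muleA; congr (_ * (_ * _%:E))%E.
by case: gN => NZ _ _ _; rewrite /ind_le (NZ _ _ (ltW s0)) -[leRHS]mulr1 ler_pM2l// mulr1.
Qed.

Lemma gauge_sublevel (R : realType) n (N : 'rV[R]_n -> R) (s : R) :
    (0 < n)%N -> gauge N ->
  lebesgue_rV n [set x | N x <= s] = (((Num.max s 0) ^+ n)%:E * lebesgue_rV n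
    [set x | (N x <= 1)%R])%E.
Proof.
move=> n0 gN; have mN := measurable_gauge gN.
case: (ltgtP s 0) => s0.
- rewrite expr0n gtn_eqF// mul0e (_ : [set x | _] = set0) ?measure0//.
  by apply/seteqP; split => x //= Nx; have := gauge_ge0 x gN;
    rewrite leNgt (le_lt_trans Nx).
- rewrite -!integral_ind_le//; try exact: measurable_cst.
  have E r : (\int[lebesgue_rV n]_t (ind_le (N t) r)%:E =
      \int[lebesgue_rV n]_t (cst 1 t * (ind_le (N t) r)%:E))%E.
    by apply: eq_integral => t _; rewrite mul1e.
  rewrite !E (integral_gauge_dilate (k := 0) gN) ?addn0// => t x _.
  by rewrite expr0 mul1e.
(* The sublevel set at 0 lies in a cube of side 0, whose volume 0^n is 0 because n > 0. *)
- rewrite s0 expr0n gtn_eqF// mul0e.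
  apply/eqP; rewrite -measure_le0.
  apply: (@le_trans _ _ (lebesgue_rV n [set x | `|x| <= 0])).
    apply: lebesgue_rV_mono => x /= Nx; case: gN => _ _ [c c0 cN] _.
    by have := le_trans (cN x) Nx; rewrite pmulr_rle0.
  by rewrite lebesgue_rV_cube// mulr0 expr0n gtn_eqF.
Qed.

(** Minus the derivative of (1 - s)^n on ]0, 1]. Writing (1 - t)_+^n as a tail integral of this
    weight reduces integrals over W to integrals over dilates of a ball. *)
Definition layer_weight (R : realType) n (s : R) : R :=
  n%:R * (onem s) ^+ n.-1 * \1_(`]0, 1]%classic : set R) s.

Lemma layer_weight_ge0 (R : realType) n (s : R) : 0 <= layer_weight n s.
Proof.
rewrite /layer_weight indicE; case: (boolP (s \in _)); rewrite ?mulr0//.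
rewrite inE /= in_itv /= mulr1 => /andP[_ s1].
by rewrite mulr_ge0// exprn_ge0// onem_ge0.
Qed.

Lemma measurable_layer_weight (R : realType) n : measurable_fun setT (@layer_weight R n).
Proof.
apply: measurable_funM; last exact: measurable_indic.
apply: measurable_funM => //; apply: measurable_funX.
exact: measurable_funB.
Qed.

Lemma layer_weight_tail (R : realType) n (t : R) : (0 < n)%N -> 0 <= t ->
  (\int[@lebesgue_measure R]_s (layer_weight n s * ind_le t s)%:E =
    ((Num.max (1 - t) 0) ^+ n)%:E)%E.
Proof.
move=> n0 t0.
pose f (s : R) : R := n%:R * (onem s) ^+ n.-1.
pose F (s : R) : R := (onem s) ^+ n * (-1).
have cf : continuous f by move=> s; apply: cvgM;
    [exact: cvg_cst|exact: continuous_onemXn].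
have cF : continuous F by move=> s; apply: cvgM;
    [exact: continuous_onemXn|exact: cvg_cst].
have mf : measurable_fun setT f by exact: continuous_measurable_fun.
pose t' := Num.min t 1.
transitivity (\int[lebesgue_measure]_(s in `]t', 1%R]) (f s)%:E)%E.
  rewrite [RHS]integral_mkcond; apply: ae_eq_integral => //.
  - apply/measurable_EFinP; apply: measurable_funM; first exact: measurable_layer_weight.
    by apply: measurable_ind_le.
  - by apply/(measurable_restrictT _ _).1 => //; apply: measurable_funTS;
    apply/measurable_EFinP.
  (* The integrands agree off these two endpoints. *)
  exists [set t; 1]; split.
  - by apply: measurableU; exact: measurable_set1.
  - by apply: countable_lebesgue_measure0; apply:
    finite_set_countable; exact: finite_set2.
  move=> s /= /not_implyP[_]; apply: contraPP => /not_orP[/eqP st /eqP s1]; apply.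
  rewrite patchE /layer_weight indicE /ind_le !mem_setE /= !in_itv/= /t'.
  case: (ltgtP s 1) s1 => // s1 _; rewrite ?andbF ?mulr0 ?mul0r//=.
  rewrite !andbT gt_min [1 < s]ltNge (ltW s1) orbF.
  case: (ltgtP t s) st => // ts _; last by rewrite mulr0.
  by rewrite (le_lt_trans t0 ts) /= !mulr1.
have t'1 : t' <= 1 by rewrite ge_min lexx orbT.
rewrite integral_itv_obnd_cbnd; last first.
  by apply: measurable_funTS; exact/measurable_EFinP.
have -> : Num.max (1 - t) 0 = 1 - t'.
  rewrite /t'; case: (leP t 1) => t1; first by rewrite max_l// subr_ge0.
  by rewrite subrr max_r// subr_le0 ltW.
move: t'1; rewrite le_eqVlt => /predU1P[->|t'1].
  by rewrite subrr expr0n gtn_eqF// set_itv1 integral_set1.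
rewrite (@continuous_FTC2 _ f F)//.
- by rewrite /F onem1 expr0n gtn_eqF//= mul0r -EFinB sub0r mulrN1 opprK.
- by apply: continuous_subspaceT; exact: cf.
- split; first by move=> s _; apply: derivableM => //; exact: onemXn_derivable.
  + by apply: cvg_at_right_filter; exact: cF.
  + by apply: cvg_at_left_filter; exact: cF.
- move=> s _; rewrite derive1Mr//; last exact: onemXn_derivable.
  by rewrite derive_onemXn mulNr mulrN1 opprK.
Qed.

(** The origin of the binomial coefficient: the integral is n B(n + 1, n) = n! n! / (2 n)!. *)
Lemma layer_weight_moment (R : realType) n : (0 < n)%N ->
  (\int[@lebesgue_measure R]_s (layer_weight n s * s ^+ n)%:E =
    ('C(2 * n, n)%:R^-1)%:E)%E.
Proof.
move=> n0.
have -> : ('C(2 * n, n)%:R^-1 = n%:R * beta_fun n.+1 n :> R).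
  case: n n0 => // n _; rewrite beta_fun_fact.
  rewrite addSnnS mul2n -addnn mulrA -natrM mulnCA -factS.
  rewrite -(@bin_fact (n.+1 + n.+1) n.+1) ?leq_addr// addnK natrM.
  rewrite -[LHS]mul1r.
  have f0 : (n.+1`! * n.+1`!)%:R != 0 :> R by rewrite pnatr_eq0 muln_eq0
      negb_or -!lt0n fact_gt0.
  by rewrite -natrM; set q := (_ * _)%N in f0 *;
    rewrite natrM invfM mulrCA divff// mulr1 mul1r.
rewrite EFinM EFin_beta_fun -ge0_integralZl_EFin//; last 2 first.
- move=> s _; rewrite lee_fin patchE; case: ifPn => //; rewrite inE => s01.
  exact: XMonemX_ge0.
- apply/measurable_EFinP; apply/(measurable_restrictT _ _).1 => //.
  exact: measurable_XMonemX.
apply: ae_eq_integral => //.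
- apply/measurable_EFinP; apply: measurable_funM; first exact: measurable_layer_weight.
  exact: measurable_funX.
- apply: measurable_funeM; apply/measurable_EFinP;
  apply/(measurable_restrictT _ _).1 => //.
  exact: measurable_XMonemX.
exists [set 0]; split; [exact: measurable_set1|exact: lebesgue_measure_set1|].
move=> s /= /not_implyP[_]; apply: contraPP => /eqP s0; apply.
rewrite patchE /layer_weight indicE !mem_setE /= !in_itv/= -EFinM; congr EFin.
case: (ltgtP s 0) s0 => // s0 _ /=; rewrite ?mulr0 ?mul0r//.
by case: (s <= 1); rewrite ?mulr0 ?mul0r//= mulr1 /XMonemX -mulrA [_ ^+ n * _]mulrC.
Qed.

(** Up to the factor |B|, (1 - N x)_+^n is the volume of the slice {y | M y <= 1 - N x} of W.
    Replace it by its tail integral, exchange the integrals, and undo the dilation by [s]. *)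
Lemma gauge_layer (R : realType) n (N : 'rV[R]_n -> R) (k : nat)
    (g : 'rV[R]_n -> \bar R) :
  (0 < n)%N -> gauge N -> measurable_fun setT g -> (forall x, 0 <= g x)%E ->
  (forall t x, 0 < t -> g (t *: x) = ((t ^+ k)%:E * g x)%E) ->
  (\int[lebesgue_rV n]_x (g x * ((Num.max (1 - N x) 0) ^+ n)%:E) =
   \int[@lebesgue_measure R]_s (layer_weight n s * s ^+ (n + k))%:E *
   \int[lebesgue_rV n]_x (g x * (ind_le (N x) 1)%:E))%E.
Proof.
move=> n0 gN mg g0 gZ; have mN := measurable_gauge gN.
pose F (p : 'rV[R]_n * measurableTypeR R) : \bar R :=
  (g p.1 * (layer_weight n p.2 * ind_le (N p.1) p.2)%:E)%E.
have mF : measurable_fun setT F.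
  apply: emeasurable_funM; first exact: (measurableT_comp mg measurable_fst).
  apply/measurable_EFinP; apply: measurable_funM.
    exact: (measurableT_comp (@measurable_layer_weight R n) measurable_snd).
  by apply: measurable_ind_le; [exact: (measurableT_comp mN measurable_fst) |
    exact: measurable_snd].
have F0 p : (0 <= F p)%E by rewrite mule_ge0//
    lee_fin mulr_ge0 ?layer_weight_ge0 ?ind_le_ge0.
transitivity (\int[lebesgue_rV n]_x \int[@lebesgue_measure R]_s F (x, s))%E.
  apply: eq_integral => x _; rewrite /F /= -layer_weight_tail ?(gauge_ge0 _ gN)//.
  rewrite -ge0_integralZl//.
  - apply/measurable_EFinP; apply: measurable_funM; first exact: measurable_layer_weight.
    by apply: measurable_ind_le.
  - by move=> s _; rewrite lee_fin mulr_ge0 ?layer_weight_ge0 ?ind_le_ge0.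
rewrite (fubini_tonelli (m1 := lebesgue_rV n) (m2 := @lebesgue_measure R) F)//.
rewrite -ge0_integralZr//; last 3 first.
- apply/measurable_EFinP; apply: measurable_funM; first exact: measurable_layer_weight.
  exact: measurable_funX.
- move=> s _; rewrite lee_fin; have [s0|s0] := leP 0 s.
    by rewrite mulr_ge0 ?layer_weight_ge0 ?exprn_ge0.
  by rewrite /layer_weight indicE mem_setE /= in_itv/= ltNge (ltW s0)/= mulr0 mul0r.
- by apply: integral_ge0 => x _; rewrite mule_ge0// lee_fin ind_le_ge0.
apply: eq_integral => s _; have [s0|s0] := leP s 0.
  have w0 : layer_weight n s = 0 by rewrite /layer_weight indicE mem_setE /=
      in_itv/= ltNge s0/= mulr0.
  by rewrite integral0_eq// => [|x _]; rewrite ?/F ?w0 ?mul0r ?mul0e ?mule0.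
rewrite EFinM -muleA -(integral_gauge_dilate gN mg g0 gZ s0) -ge0_integralZl//.
- by apply: eq_integral => x _; rewrite /F EFinM /= muleCA.
- apply: emeasurable_funM => //; apply/measurable_EFinP.
  by apply: measurable_ind_le.
- by move=> x _; rewrite mule_ge0// lee_fin ind_le_ge0.
- by rewrite lee_fin layer_weight_ge0.
Qed.

(* The integral of [G] over [W = {(x, y) | N x + M y <= 1}]. *)
Definition wint (R : realType) n (N M : 'rV[R]_n -> R)
    (G : 'rV[R]_n * 'rV[R]_n -> \bar R) : \bar R :=
  (\int[lebesgue_rV n]_x \int[lebesgue_rV n]_y (G (x, y) * (ind_le (N x + M y) 1)%:E))%E.

Lemma measurable_wint (R : realType) n (N M : 'rV[R]_n -> R)
    (G : 'rV[R]_n * 'rV[R]_n -> \bar R) :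
  gauge N -> gauge M -> measurable_fun setT G ->
  measurable_fun setT (fun p => (G p * (ind_le (N p.1 + M p.2) 1)%:E)%E).
Proof.
move=> gN gM mG; apply: emeasurable_funM => //; apply/measurable_EFinP.
apply: measurable_ind_le => //; apply: measurable_funD.
  exact: (measurableT_comp (measurable_gauge gN) measurable_fst).
exact: (measurableT_comp (measurable_gauge gM) measurable_snd).
Qed.

Lemma wint_swap (R : realType) n (N M : 'rV[R]_n -> R)
    (G : 'rV[R]_n * 'rV[R]_n -> \bar R) :
  gauge N -> gauge M -> measurable_fun setT G -> (forall p, 0 <= G p)%E ->
  wint N M G = wint M N (fun p => G (p.2, p.1)).
Proof.
move=> gN gM mG G0.
have G0' p : (0 <= G p * (ind_le (N p.1 + M p.2) 1)%:E)%E by rewrite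
    mule_ge0// lee_fin ind_le_ge0.
apply: etrans (@fubini_tonelli _ _ _ _ _ (lebesgue_rV n) (lebesgue_rV n) _
  (measurable_wint gN gM mG) G0') _.
by apply: eq_integral => y _; apply: eq_integral => x _; rewrite addrC.
Qed.

Lemma wintD (R : realType) n (N M : 'rV[R]_n -> R) (G H : 'rV[R]_n * 'rV[R]_n -> \bar R) :
  gauge N -> gauge M -> measurable_fun setT G -> (forall p, 0 <= G p)%E ->
  measurable_fun setT H -> (forall p, 0 <= H p)%E ->
  wint N M (fun p => G p + H p)%E = (wint N M G + wint N M H)%E.
Proof.
move=> gN gM mG G0 mH H0.
have I0 (F : 'rV[R]_n * 'rV[R]_n -> \bar R) p : (forall p, 0 <= F p)%E ->
    (0 <= F p * (ind_le (N p.1 + M p.2) 1)%:E)%E.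
  by move=> F0; rewrite mule_ge0// lee_fin ind_le_ge0.
have mW F := @measurable_wint R n N M F gN gM.
rewrite /wint -ge0_integralD//; last 4 first.
- by move=> x _; apply: integral_ge0 => y _; exact: (I0 G (x, y)).
- exact: (measurable_fun_fubini_tonelli_F _ (mW _ mG) (fun p => I0 _ p G0)).
- by move=> x _; apply: integral_ge0 => y _; exact: (I0 H (x, y)).
- exact: (measurable_fun_fubini_tonelli_F _ (mW _ mH) (fun p => I0 _ p H0)).
apply: eq_integral => x _; rewrite -ge0_integralD//.
- by apply: eq_integral => y _; rewrite ge0_muleDl.
- by move=> y _; exact: (I0 G (x, y)).
- exact: (measurableT_comp (mW _ mG) (measurable_pair1 x)).
- by move=> y _; exact: (I0 H (x, y)).
- exact: (measurableT_comp (mW _ mH) (measurable_pair1 x)).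
Qed.

Lemma wint_fst (R : realType) n (N M : 'rV[R]_n -> R) (k : nat) (g : 'rV[R]_n -> \bar R) :
  (0 < n)%N -> gauge N -> gauge M -> measurable_fun setT g -> (forall x, 0 <= g x)%E ->
  (forall t x, 0 < t -> g (t *: x) = ((t ^+ k)%:E * g x)%E) ->
  wint N M (fun p => g p.1) =
   (\int[@lebesgue_measure R]_s (layer_weight n s * s ^+ (n + k))%:E *
   (\int[lebesgue_rV n]_x (g x * (ind_le (N x) 1)%:E) * lebesgue_rV n
     [set x | (M x <= 1)%R]))%E.
Proof.
move=> n0 gN gM mg g0 gZ; have mN := measurable_gauge gN; have mM := measurable_gauge gM.
rewrite muleA -gauge_layer// -ge0_integralZr//; last 2 first.
- apply: emeasurable_funM => //; apply/measurable_EFinP; apply: measurable_funX.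
  by apply: measurable_maxr => //; exact: measurable_funB.
- by move=> x _; rewrite mule_ge0// lee_fin exprn_ge0// le_max lexx orbT.
apply: eq_integral => x _ /=.
rewrite ge0_integralZl//; last 2 first.
- by apply/measurable_EFinP; apply: measurable_ind_le => //; exact: measurable_funD.
- by move=> y _; rewrite lee_fin ind_le_ge0.
rewrite -muleA -gauge_sublevel// -integral_ind_le//; congr (_ * _)%E.
by apply: eq_integral => y _; rewrite /ind_le lerBrDl.
Qed.

(** The change of variables u = x + y: Tonelli, then a translation of the inner integral. *)
Lemma wint_conv (R : realType) n (N M : 'rV[R]_n -> R) (F : 'rV[R]_n -> \bar R) :
  gauge N -> gauge M -> measurable_fun setT F -> (forall x, 0 <= F x)%E ->
  (\int[lebesgue_rV n]_u (F u * \int[lebesgue_rV n]_x (ind_le (N x + M (u - x)) 1)%:E) =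
   wint N M (fun p => F (p.1 + p.2)%R))%E.
Proof.
move=> gN gM mF F0; have mN := measurable_gauge gN; have mM := measurable_gauge gM.
have mD := @measurable_rV_sub R n.
have mi : measurable_fun setT (fun p : 'rV[R]_n * 'rV[R]_n =>
    ind_le (N p.2 + M (p.1 - p.2)) 1).
  apply: measurable_ind_le => //; apply: measurable_funD.
    exact: (measurableT_comp mN measurable_snd).
  exact: (measurableT_comp mM).
pose G (p : 'rV[R]_n * 'rV[R]_n) := (F p.1 * (ind_le (N p.2 + M (p.1 - p.2)) 1)%:E)%E.
have mG : measurable_fun setT G.
  by apply: emeasurable_funM; [exact: (measurableT_comp mF measurable_fst) |
    exact/measurable_EFinP].
have G0 p : (0 <= G p)%E by rewrite mule_ge0// lee_fin ind_le_ge0.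
transitivity (\int[lebesgue_rV n]_u \int[lebesgue_rV n]_x G (u, x))%E.
  apply: eq_integral => u _; rewrite -ge0_integralZl//.
  - by apply/measurable_EFinP; exact: (measurableT_comp mi (measurable_pair1 u)).
  - by move=> x _; rewrite lee_fin ind_le_ge0.
apply: etrans (@fubini_tonelli _ _ _ _ _ (lebesgue_rV n) (lebesgue_rV n) G mG G0) _.
apply: eq_integral => x _.
rewrite -(@integral_rV_affine R n 1 x (fun u => G (u, x)))//; last first.
  exact: (measurableT_comp mG (measurable_pair2 x)).
rewrite expr1n mul1e; apply: eq_integral => y _; rewrite /G /=.
by rewrite scale1r addrK addrC.
Qed.

(** * Fibre volumes and the two bodies that bound them *)

Lemma convex_set_comb (R : realType) n (A : set 'rV[R]_n) (x y : 'rV[R]_n) (t : R) :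
  convex_set A -> 0 <= t <= 1 -> A x -> A y -> A (t *: x + (1 - t) *: y).
Proof.
move=> cA /andP[t0 t1] Ax Ay.
have := cA x y (Itv01 t0 t1) (mem_set Ax) (mem_set Ay).
by rewrite inE.
Qed.

(** x + y is the combination of x / N x and y / (1 - N x) with weights N x and 1 - N x; the second
    point lies in B since M y <= 1 - N x. The degenerate cases are split off so that both divisions
    make sense. *)
Lemma gauge_convex_hull (R : realType) n (N M : 'rV[R]_n -> R) (x y : 'rV[R]_n) :
  gauge N -> gauge M -> N x + M y <= 1 ->
  convex_hull ([set x | N x <= 1] `|` [set x | M x <= 1]) (x + y).
Proof.
move=> gN gM; move: (gN) (gM) => [NZ _ _ _] [MZ _ _ _] xy B [cB AB].
have [N0 M0] := (gauge_ge0 x gN, gauge_ge0 y gM).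
have [Nx0|Nx0] := eqVneq (N x) 0.
  rewrite (gauge_eq0 gN Nx0).
  by rewrite add0r; apply: AB; right => /=; lra.
have {}Nx0 : 0 < N x by rewrite lt_neqAle eq_sym Nx0.
have [My0|My0] := eqVneq (M y) 0.
  rewrite (gauge_eq0 gM My0).
  by rewrite addr0; apply: AB; left => /=; lra.
have {}My0 : 0 < M y by rewrite lt_neqAle eq_sym My0.
have t1 : 0 < 1 - N x by lra.
rewrite -(scalerKV (lt0r_neq0 Nx0) x) -(scalerKV (lt0r_neq0 t1) y).
apply: convex_set_comb => //; first by apply/andP; split; lra.
  by apply: AB; left => /=; rewrite NZ ?invr_ge0// mulVf// gt_eqF.
apply: AB; right => /=; rewrite MZ ?invr_ge0 ?(ltW t1)//.
by rewrite ler_pdivrMl// mulr1; lra.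
Qed.

(** The function V of the overview, as an integral to which Tonelli and [prekopa_leindler] apply
    directly. *)
Definition fiber_volume (R : realType) n (N M : 'rV[R]_n -> R) (u : 'rV[R]_n) : \bar R :=
  (\int[lebesgue_rV n]_x (ind_le (N x + M (u - x)) 1)%:E)%E.

Lemma measurable_subr (R : realType) n (u : 'rV[R]_n) :
    measurable_fun setT (fun x : 'rV[R]_n => u - x).
Proof.
apply: measurable_fun_coordP => i; under eq_fun do rewrite !mxE.
by apply: measurable_funB => //; exact: measurable_coord.
Qed.

Lemma measurable_fiber (R : realType) n (N M : 'rV[R]_n -> R) (u : 'rV[R]_n) :
    gauge N -> gauge M ->
  measurable_fun setT (fun x => N x + M (u - x)).
Proof.
move=> gN gM; apply: measurable_funD; first exact: measurable_gauge.
exact: (measurableT_comp (measurable_gauge gM) (measurable_subr u)).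
Qed.

Lemma fiber_volumeE (R : realType) n (N M : 'rV[R]_n -> R) (u : 'rV[R]_n) :
    gauge N -> gauge M ->
  fiber_volume N M u = lebesgue_rV n [set x | N x + M (u - x) <= 1].
Proof. by move=> gN gM; rewrite /fiber_volume integral_ind_le//; exact:
  measurable_fiber. Qed.

Lemma measurable_fiber_volume (R : realType) n (N M : 'rV[R]_n -> R) :
    gauge N -> gauge M ->
  measurable_fun setT (fiber_volume N M).
Proof.
move=> gN gM; have mN := measurable_gauge gN; have mM := measurable_gauge gM.
pose G (p : 'rV[R]_n * 'rV[R]_n) := (ind_le (N p.2 + M (p.1 - p.2)) 1)%:E.
have mD := @measurable_rV_sub R n.
have mG : measurable_fun setT G.
  apply/measurable_EFinP; apply: measurable_ind_le => //; apply: measurable_funD.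
    exact: (measurableT_comp mN measurable_snd).
  exact: (measurableT_comp mM).
by apply: (measurable_fun_fubini_tonelli_F G mG) => p; rewrite lee_fin ind_le_ge0.
Qed.

Lemma fiber_volume_ge0 (R : realType) n (N M : 'rV[R]_n -> R) u :
    (0 <= fiber_volume N M u)%E.
Proof. by apply: integral_ge0 => x _; rewrite lee_fin ind_le_ge0. Qed.

Lemma fiber_volume_fin (R : realType) n (N M : 'rV[R]_n -> R) u : gauge N -> gauge M ->
  fiber_volume N M u \is a fin_num.
Proof.
move=> gN gM; rewrite ge0_fin_numE; last exact: fiber_volume_ge0.
rewrite fiber_volumeE//; apply: (@le_lt_trans _ _ (lebesgue_rV n [set x | N x <= 1])).
  by apply: lebesgue_rV_mono => x /=; apply: le_trans; rewrite lerDl gauge_ge0.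
by rewrite -ge0_fin_numE//; exact: gauge_ball_fin.
Qed.

Lemma fiber_volume_gt0 (R : realType) n (N M : 'rV[R]_n -> R) : gauge N -> gauge M ->
  exists2 d, 0 < d & forall u, `|u| <= d -> (0 < fiber_volume N M u)%E.
Proof.
move=> gN gM; have h0 : 0 < 1 / 2 :> R by rewrite divr_gt0.
have [r r0 Nr] := gauge_ball_small gN h0.
have [s s0 Ms] := gauge_ball_small gM h0.
(* Then |u - x| <= 2 d <= s, so [N x] and [M (u - x)] are both at most 1 / 2. *)
pose d := Num.min r (s / 2).
have d0 : 0 < d by rewrite lt_min r0 divr_gt0.
exists d => // u ud; rewrite fiber_volumeE//.
apply: (@lt_le_trans _ _ (lebesgue_rV n [set x | `|x| <= d])).
  by rewrite lebesgue_rV_cube ?ltW// lte_fin exprn_gt0// mulr_gt0.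
apply: lebesgue_rV_mono => x /= xd.
have [dr ds] : d <= r /\ d <= s / 2 by split; rewrite ge_min lexx ?orbT.
have := Nr x (le_trans xd dr); have : M (u - x) <= 1 / 2.
  by apply: Ms; apply: (le_trans (ler_normB _ _)); lra.
by move=> *; lra.
Qed.

(** Log-concavity of V: as W is convex, combinations of points of two fibres lie in the combined
    fibre, and [prekopa_leindler] applies to the indicators. *)
Lemma fiber_volume_gmean (R : realType) n (N M : 'rV[R]_n -> R)
    (u v : 'rV[R]_n) (lam mu s t : R) :
  gauge N -> gauge M -> 0 < lam -> 0 < mu -> lam + mu = 1 -> 0 < s -> 0 < t ->
  (s%:E <= fiber_volume N M u)%E -> (t%:E <= fiber_volume N M v)%E ->
  ((gmean lam mu s t)%:E <= fiber_volume N M (lam *: u + mu *: v)%R)%E.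
Proof.
move=> gN gM lam0 mu0 lm s0 t0 su tv.
have mi w : measurable_fun setT (fun x => (ind_le (N x + M (w - x)) 1)%:E).
  by apply/measurable_EFinP; apply: measurable_ind_le => //; exact: measurable_fiber.
have i0 w x : (0 <= (ind_le (N x + M (w - x)) 1)%:E)%E by rewrite lee_fin ind_le_ge0.
apply: (prekopa_leindler lam0 mu0 lm (mi u) (mi v) (mi _) (i0 u) (i0 v)
  (i0 _) _ s0 t0 su tv).
(* A positive number is below an indicator only where the indicator is 1. *)
move=> x y a b a0 b0; rewrite !lee_fin /ind_le.
case: (boolP (N x + _ <= 1)) => [Hx a1|_]; last by rewrite leNgt a0.
case: (boolP (N y + _ <= 1)) => [Hy b1|_]; last by rewrite leNgt b0.
rewrite (_ : (_ <= 1) = true); first by rewrite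
  (le_trans (gmean_le_max (ltW lam0) (ltW mu0) lm a0 b0))// ge_max a1.
case: gN gM => [NZ NS _ _] [MZ MS _ _].
have -> : lam *: u + mu *: v - (lam *: x + mu *: y) = lam *: (u - x) + mu *: (v - y).
  by rewrite !scalerBr opprD addrACA.
apply: (@le_trans _ _ ((lam * N x + mu * N y) + (lam * M (u - x) + mu * M (v - y)))).
  rewrite -(NZ _ _ (ltW lam0)) -(NZ _ _ (ltW mu0))
    -(MZ _ _ (ltW lam0)) -(MZ _ _ (ltW mu0)).
  exact: lerD.
have -> : lam * N x + mu * N y + (lam * M (u - x) + mu * M (v - y)) =
  lam * (N x + M (u - x)) + mu * (N y + M (v - y)) by ring.
by rewrite -lm -[X in _ <= X + _]mulr1 -[X in _ <= _ + X]mulr1 lerD// ler_wpM2l// ltW.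
Qed.

(** The reciprocal turns log-concavity into convexity: the inverse of a geometric mean is the
    geometric mean of the inverses, hence at most their arithmetic mean. *)
Lemma fiber_volume_support (R : realType) n (N M : 'rV[R]_n -> R) : gauge N -> gauge M ->
  exists a, forall u, (0 < fiber_volume N M u)%E ->
    (fine (fiber_volume N M 0))^-1 + inner a u <= (fine (fiber_volume N M u))^-1.
Proof.
move=> gN gM; have [d d0 dV] := fiber_volume_gt0 gN gM.
pose V u := fine (fiber_volume N M u).
have VE u : fiber_volume N M u = (V u)%:E by rewrite fineK// fiber_volume_fin.
apply: (@supporting_hyperplane R n [set u | (0 < fiber_volume N M u)%E]
  (fun u => (V u)^-1) d d0 dV).
move=> x y lam mu /=; rewrite !VE !lte_fin => Vx Vy lam0 mu0 lm.
have := @fiber_volume_gmean R n N M x y lam mu (V x) (V y) gN gM lam0 mu0 lm Vx Vy.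
rewrite !VE !lee_fin => /(_ (lexx _) (lexx _)) H.
split; first exact: lt_le_trans (gmean_gt0 _ _ _ _) H.
apply: (@le_trans _ _ (gmean lam mu (V x) (V y))^-1).
  by rewrite lef_pV2 ?posrE ?gmean_gt0//; exact: lt_le_trans (gmean_gt0 _ _ _ _) H.
have -> : (gmean lam mu (V x) (V y))^-1 = gmean lam mu (V x)^-1 (V y)^-1.
  by rewrite /gmean !lnV ?posrE// !mulrN -opprD expRN.
by apply: gmean_le_amean; rewrite ?invr_gt0// ltW.
Qed.

(** A functional in the polar of a unit ball is bounded by the gauge, so <a - b, x> <= N x + M (- x)
    <= 1 on the fibre over 0. *)
Lemma fiber_volume_polar (R : realType) n (N M : 'rV[R]_n -> R) : gauge N -> gauge M ->
  (fiber_volume N M 0 <= lebesgue_rV n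
    (polar (minkowski_sub (polar [set x | N x <= 1]%R) (polar [set x | M x <= 1]%R))))%E.
Proof.
have polar_le (F : 'rV[R]_n -> R) x a : gauge F ->
    polar [set x | F x <= 1] a -> inner x a <= F x.
  move=> gF pa; move: (gF) => [FZ _ _ _]; have F0 := gauge_ge0 x gF.
  have [Fx0|Fx0] := eqVneq (F x) 0.
    by rewrite (gauge_eq0 gF Fx0) (gauge0 gF) -(scale0r (0 : 'rV[R]_n)) innerZl mul0r.
  have {}Fx0 : 0 < F x by rewrite lt_neqAle eq_sym Fx0.
  have := pa ((F x)^-1 *: x); rewrite /= innerZl FZ ?invr_ge0//
      mulVf ?gt_eqF// => /(_ (lexx _)).
  by rewrite mulrC ler_pdivrMr// mul1r.
move=> gN gM; rewrite fiber_volumeE//; apply: lebesgue_rV_mono => x /=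
  xW _ [a pa [b pb <-]].
have -> : inner (a - b) x = inner x a + inner (- x) b.
  by rewrite innerC innerDr -scaleN1r innerZr -[- x]scaleN1r innerZl.
by apply: le_trans xW; rewrite sub0r lerD// polar_le.
Qed.

(** * First moments and barycenters *)

Lemma maxr0_split (R : realDomainType) (u : R) :
  Num.max u 0 = u + Num.max (- u) 0.
Proof.
case: (leP u 0) => u0; first by rewrite max_l ?subrr// oppr_ge0.
by rewrite max_r ?addr0// oppr_le0 ltW.
Qed.

(* Positive parts keep all integrals in [0, +oo]; [pos_inner (- a)] is the
   negative part of [inner a]. *)
Definition pos_inner (R : realType) n (a x : 'rV[R]_n) : \bar R :=
    (Num.max (inner a x) 0)%:E.

Lemma pos_inner_ge0 (R : realType) n (a x : 'rV[R]_n) : (0 <= pos_inner a x)%E.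
Proof. by rewrite lee_fin le_max lexx orbT. Qed.

Lemma measurable_inner (R : realType) n (a : 'rV[R]_n) : measurable_fun setT (inner a).
Proof.
rewrite (_ : inner a = fun x => \sum_(i < n) a 0 i * x 0 i)//.
by apply: measurable_sum => i; apply: measurable_funM => //; exact: measurable_coord.
Qed.

Lemma measurable_pos_inner (R : realType) n (a : 'rV[R]_n) :
    measurable_fun setT (pos_inner a).
Proof.
by apply/measurable_EFinP; apply: measurable_maxr => //; exact: measurable_inner.
Qed.

Lemma pos_innerZ (R : realType) n (a x : 'rV[R]_n) (t : R) : 0 < t ->
  pos_inner a (t *: x) = ((t ^+ 1)%:E * pos_inner a x)%E.
Proof.
by move=> t0; rewrite /pos_inner innerZr expr1 -EFinM maxr_pMr ?(ltW t0)// mulr0.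
Qed.

Lemma gauge_coord_integrable (R : realType) n (N : 'rV[R]_n -> R) i : gauge N ->
  (lebesgue_rV n).-integrable [set x | N x <= 1] (fun x => (x 0 i)%:E).
Proof.
move=> gN; have [r r0 Nr] := gauge_ball_bounded gN.
apply: measurable_bounded_integrable.
- exact: measurable_gauge_ball.
- by rewrite -ge0_fin_numE//; exact: gauge_ball_fin.
- by apply: measurable_funTS; exact: measurable_coord.
- exists r; split; first by rewrite num_real.
  move=> M rM x /= Nx; apply: le_trans (coord_le_norm x i) _.
  by apply: le_trans (Nr x Nx) _; exact: ltW.
Qed.

(** [P a] and [P (- a)] are the integrals over the ball of the positive and negative parts of
    [inner a]. Boundedness of the ball makes them finite, so their difference is the signed
    moment. *)
Lemma gauge_barycenter (R : realType) n (N : 'rV[R]_n -> R) (a : 'rV[R]_n) : gauge N ->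
  let P b := (\int[lebesgue_rV n]_x (pos_inner b x * (ind_le (N x) 1)%:E))%E in
  [/\ P a \is a fin_num, P (- a) \is a fin_num &
    fine (P a) - fine (P (- a)) =
    fine (lebesgue_rV n [set x | N x <= 1]) * inner a (barycenter [set x | N x <= 1])].
Proof.
move=> gN; set A := [set x | N x <= 1]; have mA : measurable A :=
  measurable_gauge_ball gN.
have innerE x : (inner a x)%:E = (\sum_(i < n) ((a 0 i)%:E * (x 0 i)%:E))%E.
  by rewrite sumEFin; congr EFin; apply: eq_bigr => i _.
have int : (lebesgue_rV n).-integrable A (fun x => (inner a x)%:E).
  under eq_fun do rewrite innerE.
  by apply: integrable_sum => // i _; apply: integrableZl => //; exact:
    gauge_coord_integrable.
have PE : (\int[lebesgue_rV n]_(x in A) ((fun x => (inner a x)%:E) ^\+ x) =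
    \int[lebesgue_rV n]_x (pos_inner a x * (ind_le (N x) 1)%:E))%E.
  rewrite integral_mkcond; apply: eq_integral => x _; rewrite patchE /ind_le.
  case: (boolP (N x <= 1)) => Nx; last by rewrite memNset ?mule0//; exact/negP.
  by rewrite mem_set// mule1 funeposE /pos_inner EFin_max.
have QE : (\int[lebesgue_rV n]_(x in A) ((fun x => (inner a x)%:E) ^\- x) =
    \int[lebesgue_rV n]_x (pos_inner (- a) x * (ind_le (N x) 1)%:E))%E.
  rewrite integral_mkcond; apply: eq_integral => x _; rewrite patchE /ind_le.
  case: (boolP (N x <= 1)) => Nx; last by rewrite memNset ?mule0//; exact/negP.
  rewrite mem_set// mule1 funenegE /pos_inner EFin_max.
  by rewrite -[- a]scaleN1r innerZl mulN1r EFinN.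
move=> P; have Pfin : P a \is a fin_num.
  by rewrite /P -PE; apply: integrable_fin_num => //; exact: integrable_funepos.
have Qfin : P (- a) \is a fin_num.
  by rewrite /P -QE; apply: integrable_fin_num => //; exact: integrable_funeneg.
split => //; rewrite -fineB// /P -PE -QE -integralE.
under eq_integral do rewrite innerE.
rewrite integral_sum//; last by move=> i; apply: integrableZl => //; exact:
  gauge_coord_integrable.
have a0 : 0 < fine (lebesgue_rV n A).
  by rewrite fine_gt0// gauge_ball_gt0//= -ge0_fin_numE//; exact: gauge_ball_fin.
rewrite /inner mulr_sumr.
rewrite -[RHS]/(fine (\sum_(i < n) (fine (lebesgue_rV n A) * (a 0 i *
  barycenter A 0 i)))%:E).
rewrite -sumEFin; congr fine; apply: eq_bigr => i _.
rewrite mxE mulrCA mulVKf ?gt_eqF// integralZl//; last exact: gauge_coord_integrable.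
by rewrite EFinM fineK//; apply: integrable_fin_num => //; exact: gauge_coord_integrable.
Qed.

Lemma layer_weight_moment_fin (R : realType) n k : (0 < n)%N ->
  (\int[@lebesgue_measure R]_s (layer_weight n s * s ^+ (n + k))%:E)%E \is a fin_num.
Proof.
move=> n0; have pos j (s : R) : 0 <= layer_weight n s * s ^+ j.
  have [s0|s0] := leP 0 s; first by rewrite mulr_ge0 ?layer_weight_ge0 ?exprn_ge0.
  by rewrite /layer_weight indicE mem_setE /= in_itv/= ltNge (ltW s0)/= mulr0 mul0r.
rewrite ge0_fin_numE; last by apply: integral_ge0 => s _; rewrite lee_fin.
apply: (@le_lt_trans _ _ (\int[@lebesgue_measure R]_s (layer_weight n s * s ^+ n)%:E)%E).
  apply: integral_mono => s; rewrite lee_fin//.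
  rewrite /layer_weight indicE mem_setE /= in_itv/=; case: (ltP 0 s) => s0 /=;
    last by rewrite mulr0 !mul0r.
  case: (leP s 1) => s1; last by rewrite mulr0 !mul0r.
  rewrite mulr1 exprD mulrA ler_piMr ?exprn_ile1 ?(ltW s0)//.
  by rewrite !mulr_ge0 ?exprn_ge0 ?onem_ge0 ?(ltW s0).
by rewrite layer_weight_moment// ltry.
Qed.

Lemma wint_snd (R : realType) n (N M : 'rV[R]_n -> R) (k : nat) (g : 'rV[R]_n -> \bar R) :
  (0 < n)%N -> gauge N -> gauge M -> measurable_fun setT g -> (forall x, 0 <= g x)%E ->
  (forall t x, 0 < t -> g (t *: x) = ((t ^+ k)%:E * g x)%E) ->
  wint N M (fun p => g p.2) =
   (\int[@lebesgue_measure R]_s (layer_weight n s * s ^+ (n + k))%:E *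
   (\int[lebesgue_rV n]_x (g x * (ind_le (M x) 1)%:E) * lebesgue_rV n
     [set x | (N x <= 1)%R]))%E.
Proof.
move=> n0 gN gM mg g0 gZ; rewrite wint_swap//; first exact: wint_fst.
exact: (measurableT_comp mg measurable_snd).
Qed.

Lemma wint_mono (R : realType) n (N M : 'rV[R]_n -> R)
    (G H : 'rV[R]_n * 'rV[R]_n -> \bar R) :
  (forall p, 0 <= G p)%E -> (forall p, G p <= H p)%E -> (wint N M G <= wint N M H)%E.
Proof.
move=> G0 GH; have pos p : (0 <= G p * (ind_le (N p.1 + M p.2) 1)%:E)%E.
  by rewrite mule_ge0// lee_fin ind_le_ge0.
apply: integral_mono => x; first by apply: integral_ge0 => y _; exact: (pos (x, y)).
apply: integral_mono => y; first exact: (pos (x, y)).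
by apply: lee_wpmul2r; rewrite // lee_fin ind_le_ge0.
Qed.

(** Unlike the positive part of <b, x + y>, these terms depend on one variable each, so the layer
    formulas compute them. *)
Definition wint_moment (R : realType) n (N M : 'rV[R]_n -> R) (b : 'rV[R]_n) : \bar R :=
  (wint N M (fun p => pos_inner b p.1) + wint N M (fun p => pos_inner b p.2))%E.

Lemma wint_moment_barycenter (R : realType) n (N M : 'rV[R]_n -> R) (a : 'rV[R]_n) :
  (0 < n)%N -> gauge N -> gauge M ->
  barycenter [set x | N x <= 1] = - barycenter [set x | M x <= 1] ->
  wint_moment N M (- a) = wint_moment N M a /\ wint_moment N M a \is a fin_num.
Proof.
move=> n0 gN gM bar.
pose c := (\int[@lebesgue_measure R]_s (layer_weight n s * s ^+ (n + 1))%:E)%E.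
have cfin : c \is a fin_num by exact: layer_weight_moment_fin.
have [PN PN' EN] := gauge_barycenter a gN.
have [PM PM' EM] := gauge_barycenter a gM.
have Afin := gauge_ball_fin gN; have Bfin := gauge_ball_fin gM.
have SE b : wint_moment N M b = (c * (\int[lebesgue_rV n]_x (pos_inner b x *
    (ind_le (N x) 1)%:E) * lebesgue_rV n [set x | (M x <= 1)%R])
  + c * (\int[lebesgue_rV n]_x (pos_inner b x * (ind_le (M x) 1)%:E) *
    lebesgue_rV n [set x | (N x <= 1)%R]))%E.
  rewrite /wint_moment (wint_fst n0 gN gM (measurable_pos_inner b)
    (pos_inner_ge0 b) (fun t x => @pos_innerZ R n b x t)).
  by rewrite (wint_snd n0 gN gM (measurable_pos_inner b) (pos_inner_ge0 b)
    (fun t x => @pos_innerZ R n b x t)).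
split; last by rewrite SE fin_numD !fin_numM.
rewrite !SE -(fineK cfin) -(fineK PN) -(fineK PN') -(fineK PM) -(fineK PM')
  -(fineK Afin) -(fineK Bfin).
rewrite -!EFinM -!EFinD; congr EFin.
move: EN EM; rewrite bar -[- barycenter _]scaleN1r innerZr.
set io := inner a _; set pn := fine _; set qn := fine _; set al := fine _.
set pm := fine _; set qm := fine _; set be := fine _ => EN EM.
move/eqP: EN; rewrite subr_eq => /eqP ->; move/eqP: EM; rewrite subr_eq => /eqP ->.
ring.
Qed.

Lemma wint_momentE (R : realType) n (N M : 'rV[R]_n -> R) (b : 'rV[R]_n) :
    gauge N -> gauge M ->
  wint_moment N M b = wint N M (fun p => pos_inner b p.1 + pos_inner b p.2)%E.
Proof.
move=> gN gM; rewrite /wint_moment; apply/esym.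
apply: (wintD gN gM) => [|p||p]; try exact: pos_inner_ge0.
  exact: (measurableT_comp (measurable_pos_inner b) measurable_fst).
exact: (measurableT_comp (measurable_pos_inner b) measurable_snd).
Qed.

Lemma pos_innerD_le (R : realType) n (b x y : 'rV[R]_n) :
  (pos_inner b (x + y)%R <= pos_inner b x + pos_inner b y)%E.
Proof.
rewrite /pos_inner -EFinD lee_fin innerDr ge_max; apply/andP; split.
  by apply: lerD; rewrite le_max lexx.
by apply: addr_ge0; rewrite le_max lexx orbT.
Qed.

(** Additivity of [inner b] with all negative parts moved across, so that it can be integrated in
    [0, +oo]. *)
Lemma pos_innerD (R : realType) n (b x y : 'rV[R]_n) :
  (pos_inner b (x + y)%R + (pos_inner (- b)%R x + pos_inner (- b)%R y) =
   pos_inner (- b)%R (x + y)%R + (pos_inner b x + pos_inner b y))%E.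
Proof.
rewrite /pos_inner -!EFinD; congr EFin; rewrite -[- b]scaleN1r !innerZl !innerDr.
set s := inner b x; set t := inner b y.
rewrite !mulN1r (maxr0_split (s + t)) (maxr0_split s) (maxr0_split t).
by ring.
Qed.

Lemma wint_ge0 (R : realType) n (N M : 'rV[R]_n -> R)
    (G : 'rV[R]_n * 'rV[R]_n -> \bar R) :
  (forall p, 0 <= G p)%E -> (0 <= wint N M G)%E.
Proof.
move=> G0; apply: integral_ge0 => x _; apply: integral_ge0 => y _.
by apply: mule_ge0; [exact: G0|rewrite lee_fin ind_le_ge0].
Qed.

(** Transfers the equality of moments from the separate variables to x + y by integrating
    [pos_innerD]. Finiteness follows from subadditivity of the positive part. *)
Lemma wint_barycenter (R : realType) n (N M : 'rV[R]_n -> R) (a : 'rV[R]_n) :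
  (0 < n)%N -> gauge N -> gauge M ->
  barycenter [set x | N x <= 1] = - barycenter [set x | M x <= 1] ->
  wint N M (fun p => pos_inner a (p.1 + p.2)) =
    wint N M (fun p => pos_inner (- a) (p.1 + p.2)) /\
  wint N M (fun p => pos_inner a (p.1 + p.2)) \is a fin_num.
Proof.
move=> n0 gN gM bar; have [SE Sfin] := wint_moment_barycenter a n0 gN gM bar.
have madd b := measurableT_comp (measurable_pos_inner b) (@measurable_rV_add R n).
have msum b : measurable_fun setT (fun p : 'rV[R]_n * 'rV[R]_n =>
    pos_inner b p.1 + pos_inner b p.2)%E.
  apply: emeasurable_funD.
    exact: (measurableT_comp (measurable_pos_inner b) measurable_fst).
  exact: (measurableT_comp (measurable_pos_inner b) measurable_snd).
have add0 b (p : 'rV[R]_n * 'rV[R]_n) : (0 <= pos_inner b (p.1 + p.2)%R)%E by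
    exact: pos_inner_ge0.
have sum0 b (p : 'rV[R]_n * 'rV[R]_n) : (0 <= pos_inner b p.1 + pos_inner b p.2)%E.
  by apply: adde_ge0; exact: pos_inner_ge0.
have Xfin : wint N M (fun p => pos_inner a (p.1 + p.2)) \is a fin_num.
  rewrite ge0_fin_numE; last by apply: wint_ge0; exact: add0.
  apply: (@le_lt_trans _ _ (wint_moment N M a)).
    rewrite (wint_momentE _ gN gM); apply: wint_mono; first exact: add0.
    by move=> p; exact: pos_innerD_le.
  rewrite -ge0_fin_numE; first exact: Sfin.
  by rewrite (wint_momentE _ gN gM); apply: wint_ge0; exact: sum0.
split; last exact: Xfin.
have XSE : (wint N M (fun p => pos_inner a (p.1 + p.2)) + wint_moment N M (- a)%R =
   wint N M (fun p => pos_inner (- a) (p.1 + p.2)) + wint_moment N M a)%E.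
  rewrite !(wint_momentE _ gN gM).
  apply: etrans (esym (wintD gN gM (madd a) (add0 a) (msum (- a)) (sum0 (- a)))) _.
  apply: etrans _ (wintD gN gM (madd (- a)) (add0 (- a)) (msum a) (sum0 a)).
  by congr wint; apply/funext => p; exact: pos_innerD.
(* Both sides now contain the same finite moment, which cancels. *)
move: XSE; rewrite SE; move: (wint N M _) (wint N M _) (wint_moment N M a)
  Sfin => X Y S Sfin XS.
by rewrite -(addeK Y Sfin) XS addeK.
Qed.

Lemma integral_fiber_volume (R : realType) n (N M : 'rV[R]_n -> R) :
    (0 < n)%N -> gauge N -> gauge M ->
  (\int[lebesgue_rV n]_u fiber_volume N M u =
    ('C(2 * n, n)%:R^-1)%:E * (lebesgue_rV n [set x | N x <= 1]%R * lebesgue_rV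
      n [set x | M x <= 1]%R))%E.
Proof.
move=> n0 gN gM.
have m1 : measurable_fun [set: 'rV[R]_n] (cst (1%E : \bar R)) by exact: measurable_cst.
have one0 (x : 'rV[R]_n) : (0 <= cst (1%E : \bar R) x)%E by exact: lee01.
have oneZ (t : R) (x : 'rV[R]_n) : 0 < t -> cst (1%E : \bar R) (t *: x) =
    ((t ^+ 0)%:E * cst (1%E : \bar R) x)%E.
  by move=> _; rewrite expr0 mul1e.
transitivity (wint N M (fun p => cst (1%E : \bar R) (p.1 + p.2))).
  apply: etrans _ (wint_conv gN gM m1 one0).
  by apply: eq_integral => u _; rewrite mul1e.
apply: etrans (wint_fst n0 gN gM m1 one0 oneZ) _.
rewrite addn0 (layer_weight_moment _ n0); congr (_ * (_ * _))%E.
have <- : (\int[lebesgue_rV n]_x (ind_le (N x) 1)%:E =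
    lebesgue_rV n [set x | (N x <= 1)%R])%E.
  by apply: integral_ind_le; [exact: measurable_gauge|exact: measurable_cst].
by apply: eq_integral => x _; rewrite mul1e.
Qed.

(* Multiplying [phi + <a, u> <= (V u)^-1] by [V u] and integrating: the linear
   term disappears because [V] has its first moment along [a] equal to zero. *)
Lemma support_bound (R : realType) n (V : 'rV[R]_n -> \bar R) (a : 'rV[R]_n) (phi : R) :
  measurable_fun setT V -> (forall u, 0 <= V u)%E ->
    (forall u, V u \is a fin_num) -> 0 <= phi ->
  (forall u, (0 < V u)%E -> phi + inner a u <= (fine (V u))^-1) ->
  (\int[lebesgue_rV n]_u (pos_inner a u * V u) =
    \int[lebesgue_rV n]_u (pos_inner (- a)%R u * V u))%E ->
  (\int[lebesgue_rV n]_u (pos_inner a u * V u))%E \is a fin_num ->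
  (phi%:E * \int[lebesgue_rV n]_u V u <= lebesgue_rV n [set u | (0 < V u)%E])%E.
Proof.
move=> mV V0 Vfin phi0 Ha XE Xfin.
have mp b := @measurable_pos_inner R n b.
have p0 b := @pos_inner_ge0 R n b.
pose D := [set u | (0 < V u)%E].
have mD : measurable D.
  rewrite (_ : D = V @^-1` `]0%E, +oo[).
    rewrite -[X in measurable X]setTI; apply: (mV measurableT); exact: emeasurable_itv.
  by apply/seteqP; split => u; rewrite /D /= in_itv/= andbT.
have mpV b : measurable_fun setT (fun u => pos_inner b u * V u)%E by
    exact: emeasurable_funM.
have pV0 b u : (0 <= pos_inner b u * V u)%E by exact: mule_ge0.
have mphi : measurable_fun setT (fun u => phi%:E * V u)%E by exact: measurable_funeM.
have phiV u : (0 <= phi%:E * V u)%E by apply: mule_ge0; [rewrite lee_fin|].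
have mI : measurable_fun setT (fun u => (\1_D u : R)%:E) by
    apply/measurable_EFinP; exact: measurable_indic.
have I0 u : (0 <= (\1_D u : R)%:E)%E by rewrite lee_fin.
have DE : (\int[lebesgue_rV n]_u (\1_D u : R)%:E)%E =
    lebesgue_rV n D by rewrite integral_indic// setIT.
(* Add the common moment to both sides, in its positive form on the left and its negative form on
   the right. The pointwise claim becomes phi V + <a, u>_+ V <= 1_D + <a, u>_- V, with nonnegative
   terms only. *)
rewrite -(leeD2rE _ _ Xfin) {2}XE -/D -DE
  -(ge0_integralZl _ measurableT mV (fun u _ => V0 u)); last by rewrite lee_fin.
rewrite -(ge0_integralD _ measurableT (fun u _ => phiV u) mphi
  (fun u _ => pV0 a u) (mpV a)).
rewrite -(ge0_integralD _ measurableT (fun u _ => I0 u) mI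
  (fun u _ => pV0 (- a) u) (mpV (- a))).
apply: integral_mono => u; first exact: adde_ge0.
rewrite -(fineK (Vfin u)) /pos_inner -!EFinM -!EFinD lee_fin.
have [Du|Du] := boolP (u \in D); last first.
  have -> : fine (V u) = 0.
    apply/eqP; rewrite fine_eq0//; move: Du; rewrite notin_setE /D /= => /negP.
    by rewrite lt_neqAle V0 andbT negbK eq_sym.
  by rewrite !mulr0 !addr0.
move: (Du); rewrite inE /D /= => /[dup] Vu /Ha H.
have fVu : 0 < fine (V u) by rewrite fine_gt0// Vu /= -ge0_fin_numE.
rewrite indicE Du /= -[- a]scaleN1r innerZl mulN1r.
set v := fine _ in H fVu *; set l := inner a u in H *.
rewrite (maxr0_split l) mulrDl addrA lerD2r -mulrDl.
by rewrite -ler_pdivlMr// mul1r.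
Qed.

Theorem gauge_inequality (R : realType) n (N M : 'rV[R]_n -> R) :
  (0 < n)%N -> gauge N -> gauge M ->
  barycenter [set x | N x <= 1] = - barycenter [set x | M x <= 1] ->
  (lebesgue_rV n [set x | N x <= 1]%R * lebesgue_rV n [set x | M x <= 1]%R <=
   'C(2 * n, n)%:R%:E
    * lebesgue_rV n (convex_hull ([set x | N x <= 1]%R `|` [set x | M x <= 1]%R))
    * lebesgue_rV n
        (polar (minkowski_sub (polar [set x | N x <=
          1]%R) (polar [set x | M x <= 1]%R))))%E.
Proof.
move=> n0 gN gM bar.
have [a Ha] := fiber_volume_support gN gM.
have [XE Xfin] := wint_barycenter a n0 gN gM bar.
have Vfin u : fiber_volume N M u \is a fin_num by exact: fiber_volume_fin.
have V00 : (0 < fiber_volume N M 0)%E.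
  by have [d d0 dV] := fiber_volume_gt0 gN gM; apply: dV; rewrite normr0 ltW.
have XV b : wint N M (fun p => pos_inner b (p.1 + p.2)) =
    (\int[lebesgue_rV n]_u (pos_inner b u * fiber_volume N M u))%E.
  exact: (esym (wint_conv gN gM (measurable_pos_inner b) (pos_inner_ge0 b))).
rewrite !XV in XE Xfin.
have fV00 : 0 < fine (fiber_volume N M 0).
  by apply: fine_gt0; rewrite V00 /= -(ge0_fin_numE (fiber_volume_ge0 N M 0));
    exact: Vfin.
have phi0 : 0 <= (fine (fiber_volume N M 0))^-1 by rewrite invr_ge0 ltW.
have := support_bound (measurable_fiber_volume gN gM) (fiber_volume_ge0 N M)
    Vfin phi0 Ha XE Xfin.
rewrite (integral_fiber_volume n0 gN gM).
have DC : [set u | (0 < fiber_volume N M u)%E] `<=` convex_hull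
    ([set x | N x <= 1] `|` [set x | M x <= 1]).
  move=> u /=; rewrite (fiber_volumeE _ gN gM) => Vu.
  have [x Wx] : [set x | N x + M (u - x) <= 1] !=set0.
    by apply/set0P/eqP => W0; move: Vu; rewrite W0 measure0 ltxx.
  by rewrite -(subrKC x u); exact: gauge_convex_hull.
move=> /le_trans/(_ (lebesgue_rV_mono DC)).
have := fiber_volume_polar gN gM.
have C0 : 0 < 'C(2 * n, n)%:R :> R by rewrite ltr0n bin_gt0 mul2n -addnn leq_addr.
have : (lebesgue_rV n [set x | N x <= 1]%R * lebesgue_rV n
    [set x | M x <= 1]%R)%E \is a fin_num.
  by apply: fin_numM; exact: gauge_ball_fin.
have := mule_ge0 (measure_ge0 (lebesgue_rV n) [set x | N x <= 1])
  (measure_ge0 (lebesgue_rV n) [set x | M x <= 1]).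
move: fV00 (Vfin 0) (fiber_volume_ge0 N M 0); move: (fiber_volume N M 0).
move: (lebesgue_rV n _ * lebesgue_rV n _)%E => P V fV0 {}Vfin V0 P0 Pfin.
move: (lebesgue_rV n _) (lebesgue_rV n _) => hull pol H1 H2.
(* Insert V 0 and its inverse: the bound from the supporting hyperplane handles one factor and the
   bound on V 0 the other. *)
have -> : (P = 'C(2 * n, n)%:R%:E * ((fine V)^-1%:E * (('C(2 * n,
    n)%:R^-1)%:E * P)) * V)%E.
  rewrite -(fineK Pfin) -[in RHS](fineK Vfin) -!EFinM; congr EFin.
  by field; rewrite !gt_eqF.
apply: lee_pmul => //.
- apply: mule_ge0; first by rewrite lee_fin ltW.
  apply: mule_ge0; first by rewrite lee_fin invr_ge0 ltW.
  by apply: mule_ge0; [rewrite lee_fin invr_ge0 ltW|].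
- by apply: lee_wpmul2l; rewrite // lee_fin ltW.
Qed.

(** * Ball's convex bodies *)

(** The substitution r = 1 / s on a band that inversion preserves. Both sides are pulled back to
    [-k, k], one by exp (- x) and the other by exp x. *)
Lemma integral_exp_band (R : realType) (G : R -> R) (k : R) : 0 <= k ->
  {in `]0, +oo[, continuous G} ->
  (\int[@lebesgue_measure R]_(x in `[expR (- k), expR k]) (G x)%:E =
   \int[@lebesgue_measure R]_(x in `[expR (- k), expR k]) (G x^-1 * x ^- 2)%:E)%E.
Proof.
move=> k0 cG.
have kk : - k <= k by lra.
have band x : x \in `[expR (- k), expR k] -> 0 < x.
  by rewrite in_itv/= => /andP[h _]; apply: lt_le_trans h; exact: expR_gt0.
have cinv (x : R) : 0 < x -> {for x, continuous (@GRing.inv R)}.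
  by move=> x0; apply: inv_continuous; rewrite gt_eqF.
pose H x := G x^-1 * x ^- 2.
have cH x : 0 < x -> {for x, continuous H}.
  move=> x0; apply: cvgM.
    apply: (@continuous_comp _ _ _ (@GRing.inv R) G); first exact: cinv.
    by apply: cG; rewrite in_itv/= andbT invr_gt0.
  apply: (@continuous_comp _ _ _ (fun x : R => x ^+ 2) (@GRing.inv R));
    first exact: exprn_continuous.
  by apply: cinv; rewrite exprn_gt0.
have dExp (x : R) : is_derive x 1 (fun x : R => expR (- x)) (- expR (- x)).
  by apply: is_derive_eq; rewrite /GRing.scale /= ?mulr1 ?mulrN1.
have dE : ((fun x : R => expR (- x))^`() = (fun x => - expR (- x)))%classic.
  by apply/funext => x; rewrite derive1E derive_val.
have dE' : ((@expR R)^`() = @expR R)%classic.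
  by apply/funext => x; rewrite derive1E derive_val.
have cexpN : continuous (fun x : R => expR (- x)).
  by move=> x; apply/differentiable_continuous/derivable1_diffP; exact: ex_derive.
have cexpN' : continuous (fun x : R => - expR (- x)).
  by move=> x; apply: cvgN; exact: cexpN.
transitivity (\int[@lebesgue_measure R]_(x in `[(- k)%R, k])
  (G (expR (- x)) * expR (- x))%:E)%E.
  have := @integration_by_substitution_decreasing R (fun x => expR (- x)) G (- k) k kk.
  rewrite opprK dE => ->.
  - by apply: eq_integral => x _; congr EFin; rewrite !fctE opprK.
  - by move=> x y _ _ xy; rewrite ltr_expR ltrN2.
  - by move=> x _; exact: cexpN'.
  - by apply/cvg_ex; exists (- expR (- - k)); apply: cvg_at_right_filter; exact: cexpN'.
  - by apply/cvg_ex; exists (- expR (- k)); apply: cvg_at_left_filter; exact: cexpN'.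
  - split.
    + by move=> x _; exact: ex_derive.
    + by apply: cvg_at_right_filter; exact: cexpN.
    + by apply: cvg_at_left_filter; exact: cexpN.
  - apply: continuous_in_subspaceT => x; rewrite inE => /band x0; apply: cG.
    by rewrite in_itv/= x0.
have := @integration_by_substitution_increasing R expR H (- k) k kk.
rewrite dE' => ->.
- apply: eq_integral => x _; congr EFin; rewrite !fctE /H expRN -mulrA; congr (_ * _).
  by rewrite expr2 invfM -mulrA mulVf ?mulr1// gt_eqF// expR_gt0.
- by move=> x y _ _ xy; rewrite ltr_expR.
- by move=> x _; exact: continuous_expR.
- by apply/cvg_ex; exists (expR (- k)); apply: cvg_at_right_filter;
  exact: continuous_expR.
- by apply/cvg_ex; exists (expR k); apply: cvg_at_left_filter; exact: continuous_expR.
- split.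
  + by move=> x _; exact: ex_derive.
  + by apply: cvg_at_right_filter; exact: continuous_expR.
  + by apply: cvg_at_left_filter; exact: continuous_expR.
- by apply: continuous_in_subspaceT => x; rewrite inE => /band; exact: cH.
Qed.

(** The bands [exp (- k), exp k] exhaust the half-line; pass to the limit by monotone
    convergence. *)
Lemma integral_inv (R : realType) (G : R -> R) : {in `]0, +oo[, continuous G} ->
  (forall x, 0 < x -> 0 <= G x) ->
  (\int[@lebesgue_measure R]_(x in `]0%R, +oo[) (G x)%:E =
   \int[@lebesgue_measure R]_(x in `]0%R, +oo[) (G x^-1 * x ^- 2)%:E)%E.
Proof.
move=> cG G0; pose B (k : nat) := `[expR (- k%:R), expR k%:R]%classic : set R.
have BU : \bigcup_k B k = `]0, +oo[%classic.
  apply/seteqP; split => x /=.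
    by move=> [k _]; rewrite /B /= !in_itv/= andbT => /andP[h _]; apply:
      lt_le_trans h; exact: expR_gt0.
  rewrite in_itv/= andbT => x0.
  have [k Hk] : exists k : nat, `|ln x| <= k%:R.
    by exists (Num.bound `|ln x|); apply: ltW; exact: archi_boundP.
  exists k => //; rewrite /B /= in_itv/=; move: Hk; rewrite ler_norml => /andP[h1 h2].
  have xE : x = expR (ln x) by rewrite lnK.
  by rewrite xE !ler_expR h1 h2.
have Bpos k x : B k x -> 0 < x.
  by rewrite /B /= in_itv/= => /andP[h _]; apply: lt_le_trans h; exact: expR_gt0.
have ndB : nondecreasing_seq B.
  move=> k l kl; apply/subsetPset => x; rewrite /B /= !in_itv/= => /andP[h1 h2].
  by apply/andP; split; [apply: le_trans h1|apply: le_trans h2 _];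
    rewrite ler_expR ?lerN2 ler_nat.
have mB k : measurable (B k) by exact: measurable_itv.
have cmeas (F : R -> R) k : (forall x, 0 < x -> {for x, continuous F}) ->
    measurable_fun (B k) (fun x => (F x)%:E).
  move=> cF; apply/measurable_EFinP; apply: subspace_continuous_measurable_fun => //.
  by apply: continuous_in_subspaceT => x; rewrite inE => /Bpos; exact: cF.
have cinv (x : R) : 0 < x -> {for x, continuous (@GRing.inv R)}.
  by move=> x0; apply: inv_continuous; rewrite gt_eqF.
have cH (x : R) : 0 < x -> {for x, continuous (fun x : R => G x^-1 * x ^- 2)}.
  move=> x0; apply: cvgM.
    apply: (@continuous_comp _ _ _ (@GRing.inv R) G); first exact: cinv.
    by apply: cG; rewrite in_itv/= andbT invr_gt0.
  apply: (@continuous_comp _ _ _ (fun x : R => x ^+ 2) (@GRing.inv R));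
    first exact: exprn_continuous.
  by apply: cinv; rewrite exprn_gt0.
have cG' (x : R) : 0 < x -> {for x, continuous G} by move=> x0; apply:
    cG; rewrite in_itv/= x0.
rewrite -BU.
have L1 := ge0_nondecreasing_set_cvg_integral (mu := @lebesgue_measure R) ndB mB
    (fun k => cmeas G k cG')
  (fun k x Bx => G0 x (Bpos k x Bx)).
have H0 k x : B k x -> (0 <= (G x^-1 * x ^- 2)%:E)%E.
  by move=> /Bpos x0; rewrite lee_fin mulr_ge0//
    ?invr_ge0 ?exprn_ge0 ?(ltW x0)// G0// invr_gt0.
have L2 := ge0_nondecreasing_set_cvg_integral (mu := @lebesgue_measure R) ndB mB
    (fun k => cmeas _ k cH) H0.
have E : (fun i => \int[@lebesgue_measure R]_(x in B i) (G x)%:E)%E =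
    (fun i => \int[@lebesgue_measure R]_(x in B i) (G x^-1 * x ^- 2)%:E)%E.
  by apply/funext => i; rewrite /B integral_exp_band// ler0n.
rewrite E in L1.
by apply: etrans (esym (cvg_lim _ L1)) (cvg_lim _ L2).
Qed.

(** * Radial integrals and the convexity of their unit balls *)

Definition radial_integral (R : realType) n (h : 'rV[R]_n -> R) (y : 'rV[R]_n) : \bar R :=
  (\int[lebesgue_measure]_(r in `[0%R, +oo[) (r ^+ n.-1 * expR (- h (r *: y)))%:E)%E.

(** [Lp_polar_norm] with the support function abstracted; for finite p the two are convertible. *)
Definition radial_norm (R : realType) n (h : 'rV[R]_n -> R) (y : 'rV[R]_n) : R :=
  match radial_integral h y with
  | v%:E => (v / n.-1`!%:R) `^ (- n%:R^-1)
  | _ => 0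
  end.

(** Convexity of [h] makes the unit ball convex; the Lipschitz bound gives continuity along rays
    and, with h 0 = 0, a lower bound for the radial integral; h 0 = 0 makes it infinite at 0; linear
    growth makes it finite elsewhere. *)
Definition support_like (R : realType) n (h : 'rV[R]_n -> R) := [/\
  forall x y lam mu, 0 < lam -> 0 < mu -> lam + mu = 1 ->
    h (lam *: x + mu *: y) <= lam * h x + mu * h y,
  exists2 C, 0 < C & forall x y, h y <= h x + C * `|y - x|,
  h 0 = 0 &
  exists d c, 0 < d /\ forall x, d * `|x| - c <= h x].

Lemma lipschitz_continuous (R : realType) (f : R -> R) (C : R) : 0 <= C ->
  (forall x y, f y <= f x + C * `|y - x|) -> continuous f.
Proof.
move=> C0 fC x; pose C' := C + 1.
have C'0 : 0 < C' by rewrite /C'; lra.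
apply: (proj2 (@cvgrPdist_lt _ _ _ (nbhs x) _ f (f x))) => e e0.
have : \forall y \near x, `|x - y| < e / C'.
  apply/nbhs_ballP; exists (e / C'); first by rewrite /= divr_gt0.
  by move=> y; rewrite -ball_normE.
apply: (@filterS _ (nbhs x) _) => y yx.
have h : C' * `|x - y| < e by rewrite mulrC -ltr_pdivlMr.
have h1 := fC x y; have h2 := fC y x; rewrite distrC in h1.
have h3 := normr_ge0 (x - y).
rewrite /C' mulrDl mul1r in h.
by rewrite ltr_norml; apply/andP; split; lra.
Qed.

Lemma support_like_ray_continuous (R : realType) n (h : 'rV[R]_n -> R) (y : 'rV[R]_n) :
  support_like h -> continuous (fun r : R => h (r *: y)).
Proof.
case=> _ [C C0 hC] _ _; apply: (@lipschitz_continuous R _ (C * `|y|)).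
  by rewrite mulr_ge0// ltW.
by move=> r s; apply: le_trans (hC (r *: y) _) _;
  rewrite -scalerBl normrZ -mulrA (mulrC `|y|).
Qed.

Lemma radial_integrand_continuous (R : realType) n (h : 'rV[R]_n -> R) (y : 'rV[R]_n) :
  support_like h -> continuous (fun r : R => r ^+ n.-1 * expR (- h (r *: y))).
Proof.
move=> sh r; apply: cvgM; first exact: exprn_continuous.
apply: (@continuous_comp _ _ _ (fun r : R => - h (r *: y)) expR);
  last exact: continuous_expR.
by apply: cvgN; exact: support_like_ray_continuous.
Qed.

Lemma measurable_radial_integrand (R : realType) n (h : 'rV[R]_n -> R) (y : 'rV[R]_n) D :
  support_like h -> measurable_fun D (fun r : R => (r ^+ n.-1 * expR (- h (r *: y)))%:E).
Proof.
move=> sh; apply: measurable_funTS; apply/measurable_EFinP; apply: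
  continuous_measurable_fun.
exact: radial_integrand_continuous.
Qed.

Lemma radial_integral0 (R : realType) n (h : 'rV[R]_n -> R) : support_like h ->
    radial_integral h 0 = +oo%E.
Proof.
move=> sh; apply/eqP; rewrite -leye_eq.
apply: (@le_trans _ _ (\int[@lebesgue_measure R]_(r in `[1%R,
  +oo[) (cst (1%:E : \bar R) r))%E).
  by rewrite integral_cst//= lebesgue_measure_itv/= ltry mul1e addye.
apply: (@le_trans _ _ (\int[@lebesgue_measure R]_(r in `[1%R, +oo[) (r ^+
  n.-1 * expR (- h (r *: 0)))%:E)%E).
  apply: ge0_le_integral => //; first exact: measurable_radial_integrand.
  move=> r /=; rewrite in_itv/= andbT => r1; case: sh => _ _ h0 _.
  by rewrite scaler0 h0 oppr0 expR0 mulr1 lee_fin exprn_ege1.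
apply: ge0_subset_integral => //.
- exact: measurable_radial_integrand.
- by move=> r /=; rewrite in_itv/= andbT => r0;
  rewrite lee_fin mulr_ge0 ?exprn_ge0 ?expR_ge0.
- by move=> r /=; rewrite !in_itv/= !andbT; apply: le_trans.
Qed.

Lemma radial_integral_mkcond (R : realType) n (h : 'rV[R]_n -> R) (y : 'rV[R]_n) :
  radial_integral h y = (\int[@lebesgue_measure R]_r
    (ind_le 0 r * (r ^+ n.-1 * expR (- h (r *: y))))%:E)%E.
Proof.
rewrite /radial_integral integral_mkcond; apply: eq_integral => r _.
rewrite patchE /ind_le; have [r0|r0] := leP 0 r.
  by rewrite mem_set ?mul1r//= in_itv/= r0.
by rewrite memNset ?mul0r//= in_itv/= leNgt r0.
Qed.

Lemma radial_integralZ (R : realType) n (h : 'rV[R]_n -> R) (y : 'rV[R]_n) (t : R) :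
  (0 < n)%N -> support_like h -> 0 < t ->
  ((t ^+ n)%:E * radial_integral h (t *: y))%E = radial_integral h y.
Proof.
move=> n0 sh t0.
have mf z : measurable_fun setT (fun r : R =>
    (ind_le 0 r * (r ^+ n.-1 * expR (- h (r *: z))))%:E).
  apply/measurable_EFinP; apply: measurable_funM; first exact: measurable_ind_le.
  by apply: continuous_measurable_fun; exact: radial_integrand_continuous.
have f0 z (r : R) : (0 <= (ind_le 0 r * (r ^+ n.-1 * expR (- h (r *: z))))%:E)%E.
  rewrite lee_fin /ind_le; have [r0|r0] := leP 0 r; last by rewrite mul0r.
  by rewrite mul1r mulr_ge0 ?exprn_ge0 ?expR_ge0.
rewrite !radial_integral_mkcond -(integral_affine 0 t0 (mf y) (f0 y)).
have -> : (t ^+ n)%:E = (t%:E * (t ^+ n.-1)%:E)%E by rewrite -EFinM -exprS prednK.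
rewrite -muleA -ge0_integralZl//; last 2 first.
- exact: mf.
- by rewrite lee_fin exprn_ge0// ltW.
congr (_ * _)%E; apply: eq_integral => r _; rewrite addr0 -EFinM; congr EFin.
rewrite scalerA (mulrC r t) exprMn /ind_le pmulr_rge0//; ring.
Qed.

Lemma radial_integral_inv (R : realType) n (h : 'rV[R]_n -> R) (y : 'rV[R]_n) :
  (0 < n)%N -> support_like h ->
  radial_integral h y =
  (\int[@lebesgue_measure R]_s (if (0 < s)%R then s ^- n.+1 * expR (- h (s^-1
    *: y)) else 0)%:E)%E.
Proof.
move=> n0 sh; rewrite /radial_integral -integral_itv_obnd_cbnd; last exact:
  measurable_radial_integrand.
rewrite (integral_inv (G := fun r => r ^+ n.-1 * expR (- h (r *: y)))); last 2 first.
- by move=> r _; exact: radial_integrand_continuous.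
- by move=> r r0; rewrite mulr_ge0 ?exprn_ge0 ?expR_ge0 ?ltW.
rewrite integral_mkcond; apply: eq_integral => s _; rewrite patchE; case: ifPn => [|].
  rewrite inE/= in_itv/= andbT => s0; rewrite s0; congr EFin.
  (* The powers combine as (1 / s)^(n - 1) * s^(-2) = s^(- (n + 1)). *)
  by rewrite exprVn mulrAC -invfM -exprD addn2 prednK.
rewrite notin_setE/= in_itv/= andbT => /negP/negbTE -> //.
Qed.

Lemma measurable_radial_inv (R : realType) n (h : 'rV[R]_n -> R)
    (y : 'rV[R]_n) : support_like h ->
  measurable_fun setT (fun s : R => (if 0 < s then s ^- n.+1 * expR (- h
    (s^-1 *: y)) else 0)%:E).
Proof.
move=> sh; apply/measurable_EFinP; apply: measurable_fun_if => //.
- by apply: measurable_fun_ltr.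
- rewrite setTI; set D := (X in measurable_fun X).
  have DE : D = `]0, +oo[%classic.
    by apply/seteqP; split => s; rewrite /D /= in_itv/= andbT.
  rewrite DE; apply: subspace_continuous_measurable_fun; first exact: measurable_itv.
  apply: continuous_in_subspaceT => s; rewrite inE/= in_itv/= andbT => s0.
  have cinv : {for s, continuous (@GRing.inv R)} by apply: inv_continuous; rewrite gt_eqF.
  apply: cvgM.
    apply: (@continuous_comp _ _ _ (fun x : R => x ^+ n.+1) (@GRing.inv R));
      first exact: exprn_continuous.
    by apply: inv_continuous; rewrite gt_eqF// exprn_gt0.
  apply: (@continuous_comp _ _ _ (fun x : R => - h (x^-1 *: y)) expR);
    last exact: continuous_expR.
  apply: cvgN; apply: (@continuous_comp _ _ _ (@GRing.inv R) (fun r => h (r *: y))) => //.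
  exact: support_like_ray_continuous.
Qed.

Lemma radial_integral_ge (R : realType) n (h : 'rV[R]_n -> R) : support_like h ->
  exists2 m, 0 < m & forall y, `|y| <= 1 -> (m%:E <= radial_integral h y)%E.
Proof.
move=> sh; case: (sh) => _ [C C0 hC] h0 _.
(* Only [1/2, 1] is integrated: there r^(n - 1) >= (1/2)^(n - 1), and h (r y) <= C by the Lipschitz
   bound at 0. *)
pose m := (1 / 2) ^+ n.-1 * expR (- C) * (1 / 2) : R.
have m0 : 0 < m by rewrite /m !mulr_gt0 ?expR_gt0 ?exprn_gt0.
exists m => // y y1.
apply: (@le_trans _ _ (\int[@lebesgue_measure R]_(r in `[(1 / 2)%R,
  1%R]) (cst ((1 / 2) ^+ n.-1 * expR (- C))%:E r))%E).
  rewrite integral_cst//= lebesgue_measure_itv/= lte_fin ifT; last lra.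
  by rewrite -EFinB -EFinM lee_fin /m ler_wpM2l ?mulr_ge0 ?expR_ge0 ?exprn_ge0//; lra.
apply: (@le_trans _ _ (\int[@lebesgue_measure R]_(r in `[(1 / 2)%R, 1%R]) (r ^+
  n.-1 * expR (- h (r *: y)))%:E)%E).
  apply: ge0_le_integral => //.
  - by move=> r _; rewrite lee_fin mulr_ge0 ?expR_ge0 ?exprn_ge0.
  - exact: measurable_radial_integrand.
  move=> r /=; rewrite in_itv/= => /andP[r1 r2].
  have r0 : 0 <= r by lra.
  rewrite lee_fin ler_pM ?expR_ge0 ?exprn_ge0//.
    by apply: lerXn2r => //; rewrite nnegrE.
  rewrite ler_expR lerN2; have := hC 0 (r *: y).
  rewrite h0 add0r subr0 normrZ (ger0_norm r0) => /le_trans; apply.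
  by rewrite -[leRHS]mulr1 ler_pM2l// mulr_ile1.
apply: ge0_subset_integral => //.
- exact: measurable_radial_integrand.
- by move=> r /=; rewrite in_itv/= andbT => r0;
  rewrite lee_fin mulr_ge0 ?exprn_ge0 ?expR_ge0.
- move=> r /=; rewrite !in_itv/= andbT => /andP[r1 _]; lra.
Qed.

Lemma radial_integral_le (R : realType) n (h : 'rV[R]_n -> R) :
    (0 < n)%N -> support_like h ->
  exists2 M, 0 < M & forall y, `|y| = 1 -> (radial_integral h y <= M%:E)%E.
Proof.
move=> n0 sh; case: (sh) => _ _ _ [d [c [d0 hd]]].
(* From r <= k exp (r / k), the power r^(n - 1) costs at most exp (n r / k) = exp (d r / 2). Half of
   the decay is left, and the bound is a multiple of an exponential density. *)
pose k := 2 * n%:R / d : R.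
have nR0 : 0 < n%:R :> R by rewrite ltr0n.
have k0 : 0 < k by rewrite /k divr_gt0// mulr_gt0.
have d20 : 0 < d / 2 by rewrite divr_gt0.
pose M := k ^+ n.-1 * expR c * (d / 2)^-1.
have M0 : 0 < M by rewrite /M !mulr_gt0 ?expR_gt0 ?exprn_gt0 ?invr_gt0.
exists M => // y y1.
have M1 : (M%:E = \int[@lebesgue_measure R]_r (M%:E * (exponential_pdf (d / 2) r)%:E))%E.
  rewrite ge0_integralZl//.
  - by rewrite integral_exponential_pdf// mule1.
  - by apply/measurable_EFinP; exact: measurable_exponential_pdf.
  - by move=> r _; rewrite lee_fin exponential_pdf_ge0// ltW.
  - by rewrite lee_fin ltW.
rewrite M1 radial_integral_mkcond; apply: integral_mono => r.
  rewrite lee_fin /ind_le; have [r0|r0] := leP 0 r; last by rewrite mul0r.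
  by rewrite mul1r mulr_ge0 ?exprn_ge0 ?expR_ge0.
rewrite -EFinM lee_fin /ind_le; have [r0|r0] := leP 0 r; last first.
  by rewrite mul0r mulr_ge0 ?(ltW M0)// exponential_pdf_ge0// ltW.
rewrite exponential_pdfE// mul1r /M.
have -> : k ^+ n.-1 * expR c / (d / 2) * (d / 2 * expR (- (d / 2) * r)) =
    k ^+ n.-1 * expR (d / 2 * r) * expR (c - d * r).
  rewrite -mulrA mulKf ?gt_eqF// -!(mulrA (k ^+ _)) -!expRD; congr (_ * expR _); lra.
apply: ler_pM; rewrite ?exprn_ge0 ?expR_ge0//; last first.
  rewrite ler_expR; have := hd (r *: y); rewrite normrZ y1 mulr1 ger0_norm//; lra.
have rk : r <= k * expR (r / k).
  have := expR_ge1Dx (r / k); rewrite -ler_pdivrMl// mulrC => h1; lra.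
apply: (@le_trans _ _ ((k * expR (r / k)) ^+ n.-1)).
  by apply: lerXn2r; rewrite ?nnegrE// (le_trans r0 rk).
rewrite exprMn ler_wpM2l ?exprn_ge0 ?(ltW k0)// -expRM_natl ler_expR.
have -> : d / 2 * r = n%:R * (r / k) by rewrite /k; field; rewrite !gt_eqF.
by apply: ler_wpM2r; [rewrite divr_ge0// ltW|rewrite ler_nat leq_pred].
Qed.

Lemma radial_integral_fin (R : realType) n (h : 'rV[R]_n -> R) (y : 'rV[R]_n) :
    (0 < n)%N -> support_like h ->
  y != 0 -> exists2 v, 0 < v & radial_integral h y = v%:E.
Proof.
move=> n0 sh y0; have ny : 0 < `|y| by rewrite normr_gt0.
have u1 : `|(`|y|^-1 *: y)| = 1.
  by rewrite normrZ ger0_norm ?invr_ge0// mulVf// gt_eqF.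
have [m m0 Hm] := radial_integral_ge sh; have [M M0 HM] := radial_integral_le n0 sh.
have := Hm (`|y|^-1 *: y); rewrite u1 => /(_ (lexx _)); have := HM _ u1.
rewrite -(radial_integralZ y n0 sh (t := `|y|^-1)) ?invr_gt0//.
case: (radial_integral h _) => [v| |] //; rewrite !lee_fin => vM mv.
by exists (`|y|^-1 ^+ n * v); rewrite ?EFinM//
  mulr_gt0 ?exprn_gt0 ?invr_gt0// (lt_le_trans m0).
Qed.

Lemma radial_norm0 (R : realType) n (h : 'rV[R]_n -> R) :
    support_like h -> radial_norm h 0 = 0.
Proof. by move=> sh; rewrite /radial_norm radial_integral0. Qed.

(** Turns membership in the ball into a threshold on the integral, the form that [harmonic_1D]
    accepts. *)
Lemma radial_norm_le1 (R : realType) n (h : 'rV[R]_n -> R) (y : 'rV[R]_n) :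
    (0 < n)%N -> support_like h ->
  (radial_norm h y <= 1) = (n.-1`!%:R%:E <= radial_integral h y)%E.
Proof.
move=> n0 sh; have [->|y0] := eqVneq y 0; first by rewrite radial_norm0//
  radial_integral0// ler01 leey.
have [v v0 E] := radial_integral_fin n0 sh y0; rewrite /radial_norm E lee_fin.
have f0 : 0 < n.-1`!%:R :> R by rewrite ltr0n fact_gt0.
have vf : 0 < v / n.-1`!%:R by rewrite divr_gt0.
rewrite /powR gt_eqF// -[X in expR _ <= X]expR0 ler_expR mulNr oppr_le0
  pmulr_rge0 ?invr_gt0 ?ltr0n//.
by rewrite -[X in X <= ln _]ln1 ler_ln ?posrE// ler_pdivlMr// mul1r.
Qed.

Lemma radial_normZ (R : realType) n (h : 'rV[R]_n -> R) (y : 'rV[R]_n) (t : R) :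
    (0 < n)%N -> support_like h ->
  0 <= t -> radial_norm h (t *: y) = t * radial_norm h y.
Proof.
move=> n0 sh; rewrite le_eqVlt => /predU1P[<-|t0];
  first by rewrite scale0r mul0r radial_norm0.
have [->|y0] := eqVneq y 0; first by rewrite scaler0 radial_norm0// mulr0.
have ty0 : t *: y != 0 by rewrite scaler_eq0 negb_or gt_eqF.
have [w w0 Ew] := radial_integral_fin n0 sh ty0.
have := radial_integralZ y n0 sh t0; rewrite /radial_norm Ew -EFinM => <-.
rewrite -mulrA; set X := w / _.
have X0 : 0 <= X by rewrite divr_ge0// ltW.
rewrite powRM ?exprn_ge0 ?(ltW t0)//.
rewrite mulrA -powR_mulrn ?(ltW t0)// -powRrM mulrN mulfV ?pnatr_eq0 -?lt0n//.
by rewrite powR_inv1 ?(ltW t0)// mulfV ?mul1r// gt_eqF.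
Qed.

Lemma perspective_convex (R : realType) n (h : 'rV[R]_n -> R)
    (x y : 'rV[R]_n) (lam mu s t : R) :
  support_like h -> 0 < lam -> 0 < mu -> lam + mu = 1 -> 0 < s -> 0 < t ->
  (lam * s + mu * t) ^+ n.+1 * expR (h ((lam * s + mu * t)^-1 *: (lam *: x + mu *: y))) <=
  lam * (s ^+ n.+1 * expR (h (s^-1 *: x))) + mu * (t ^+ n.+1 * expR (h (t^-1 *: y))).
Proof.
case=> hconv _ _ _ lam0 mu0 lm s0 t0; set z := lam * s + mu * t.
have z0 : 0 < z by rewrite addr_gt0// mulr_gt0.
(* With these weights the argument of [h] at [z] is a convex combination of the two given
   arguments. *)
pose a := lam * s / z; pose b := mu * t / z.
have a0 : 0 < a by rewrite divr_gt0// mulr_gt0.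
have b0 : 0 < b by rewrite divr_gt0// mulr_gt0.
have ab : a + b = 1 by rewrite -mulrDl divff// gt_eqF.
have -> : z^-1 *: (lam *: x + mu *: y) = a *: (s^-1 *: x) + b *: (t^-1 *: y).
  rewrite scalerDr !scalerA; congr (_ *: _ + _ *: _); rewrite /a /b;
    field; by rewrite !gt_eqF.
set h0 := h (s^-1 *: x); set h1 := h (t^-1 *: y).
have H := hconv (s^-1 *: x) (t^-1 *: y) a b a0 b0 ab.
(* [z] is the harmonic mean of [s] and [t] for the weights [a] and [b]. *)
have zg : z <= gmean a b s t.
  rewrite -[leLHS]invrK -[leRHS]invrK lef_pV2 ?posrE ?invr_gt0 ?gmean_gt0//.
  have -> : (gmean a b s t)^-1 = gmean a b s^-1 t^-1.
    by rewrite /gmean !lnV ?posrE// !mulrN -opprD expRN.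
  apply: le_trans (gmean_le_amean (ltW a0) (ltW b0) ab _ _) _; rewrite ?invr_gt0//.
  have -> : a / s + b / t = (lam + mu) / z by rewrite /a /b; field; rewrite !gt_eqF.
  by rewrite lm mul1r.
have expn (c : R) k : 0 < c -> c ^+ k = expR (k%:R * ln c).
  by move=> c0; rewrite expRM_natl lnK.
(* Of the n + 1 powers, one is absorbed into the weights [a] and [b]; the other n enter the
   exponential as n ln s and n ln t, where Jensen applies. *)
have step : z ^+ n * expR (h (a *: (s^-1 *: x) + b *: (t^-1 *: y))) <=
    a * (s ^+ n * expR h0) + b * (t ^+ n * expR h1).
  rewrite (expn s)// (expn t)// -!expRD.
  apply: le_trans (expR_jensen _ _ (ltW a0) (ltW b0) ab).
  have -> : a * (n%:R * ln s + h0) + b * (n%:R * ln t + h1) =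
    n%:R * (a * ln s + b * ln t) + (a * h0 + b * h1) by ring.
  rewrite expRD expRM_natl; apply: ler_pM;
    rewrite ?expR_ge0 ?exprn_ge0 ?(ltW z0) ?ler_expR//.
  by apply: lerXn2r; rewrite ?nnegrE ?expR_ge0 ?(ltW z0).
have -> : lam * (s ^+ n.+1 * expR h0) + mu * (t ^+ n.+1 * expR h1) =
    z * (a * (s ^+ n * expR h0) + b * (t ^+ n * expR h1)).
  rewrite !exprS /a /b; field; by rewrite gt_eqF.
by rewrite exprS -mulrA ler_pM2l.
Qed.

Lemma radial_norm_convex (R : realType) n (h : 'rV[R]_n -> R)
    (x y : 'rV[R]_n) (lam mu : R) :
  (0 < n)%N -> support_like h -> 0 < lam -> 0 < mu -> lam + mu = 1 ->
  radial_norm h x <= 1 -> radial_norm h y <= 1 -> radial_norm h (lam *: x + mu *: y) <= 1.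
Proof.
move=> n0 sh lam0 mu0 lm; rewrite (radial_norm_le1 x n0 sh)
  (radial_norm_le1 y n0 sh) (radial_norm_le1 (lam *: x + mu *: y) n0 sh).
rewrite (radial_integral_inv x n0 sh) (radial_integral_inv y n0 sh)
  (radial_integral_inv (lam *: x + mu *: y) n0 sh).
have f0 : 0 < n.-1`!%:R :> R by rewrite ltr0n fact_gt0.
have mPhi z := @measurable_radial_inv R n h z sh.
have Phi0 z (s : R) : (0 <= (if (0 < s)%R then s ^- n.+1 * expR (- h (s^-1
    *: z)) else 0)%:E)%E.
  rewrite lee_fin; case: ifP => // s0.
  by rewrite mulr_ge0 ?expR_ge0// invr_ge0 exprn_ge0// ltW.
apply: (harmonic_1D lam0 mu0 lm (mPhi x) (mPhi y) (mPhi _) (Phi0 x)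
  (Phi0 y) (Phi0 _) _ f0).
move=> s t u v u0 v0; rewrite !lee_fin.
have [s0|_] := ltP 0 s; last by rewrite leNgt u0.
move=> us; have [t0|_] := ltP 0 t; last by rewrite leNgt v0.
move=> vt; have z0 : 0 < lam * s + mu * t by rewrite addr_gt0// mulr_gt0.
rewrite z0; set z := lam * s + mu * t in z0 *.
have inv (c w : R) : 0 < c -> c ^- n.+1 * expR (- w) = (c ^+ n.+1 * expR w)^-1.
  by move=> c0; rewrite expRN invfM.
rewrite inv//; rewrite inv// in us; rewrite inv// in vt.
have pos (c w : R) : 0 < c -> 0 < c ^+ n.+1 * expR w by move=> c0;
    rewrite mulr_gt0 ?expR_gt0 ?exprn_gt0.
rewrite lef_pV2 ?posrE ?pos//; last by rewrite addr_gt0// divr_gt0.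
apply: le_trans (perspective_convex x y sh lam0 mu0 lm s0 t0) _.
apply: lerD; rewrite ler_pM2l//.
  by rewrite -[leLHS]invrK lef_pV2 ?posrE ?invr_gt0 ?pos.
by rewrite -[leLHS]invrK lef_pV2 ?posrE ?invr_gt0 ?pos.
Qed.

(** Subadditivity: combine x / N x and y / N y with weights proportional to N x and N y. The bounds
    on the unit sphere extend by homogeneity. *)
Lemma gauge_of_convex_ball (R : realType) n (N : 'rV[R]_n -> R) (c C : R) :
  (forall t x, 0 <= t -> N (t *: x) = t * N x) ->
  (forall x y lam mu, 0 < lam -> 0 < mu -> lam + mu = 1 -> N x <= 1 -> N y <= 1 ->
    N (lam *: x + mu *: y) <= 1) ->
  0 < c -> (forall x, `|x| = 1 -> c <= N x <= C) -> gauge N.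
Proof.
move=> NZ Nconv c0 NcC.
have N0 : N 0 = 0 by rewrite -(scale0r (0 : 'rV[R]_n)) NZ// mul0r.
have NE (x : 'rV[R]_n) : x != 0 -> exists2 u, `|u| = 1 & N x = `|x| * N u.
  move=> x0; have nx : 0 < `|x| by rewrite normr_gt0.
  exists (`|x|^-1 *: x).
    by rewrite normrZ ger0_norm ?invr_ge0// mulVf// gt_eqF.
  by rewrite -NZ// scalerA divff ?scale1r// gt_eqF.
have Npos (x : 'rV[R]_n) : x != 0 -> 0 < N x.
  move=> x0; have [u /NcC /andP[cu _] ->] := NE x x0.
  by rewrite mulr_gt0 ?normr_gt0//; exact: lt_le_trans cu.
split => //.
- move=> x y; have [->|x0] := eqVneq x 0; first by rewrite N0 !add0r.
  have [->|y0] := eqVneq y 0; first by rewrite N0 !addr0.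
  have a0 := Npos x x0; have b0 := Npos y y0.
  set a := N x in a0 *; set b := N y in b0 *.
  have ab0 : 0 < a + b by rewrite addr_gt0.
  have ab1 : a / (a + b) + b / (a + b) = 1 by rewrite -mulrDl divff// gt_eqF.
  have Na : N (a^-1 *: x) <= 1 by rewrite NZ ?invr_ge0 ?(ltW a0)// mulVf// gt_eqF.
  have Nb : N (b^-1 *: y) <= 1 by rewrite NZ ?invr_ge0 ?(ltW b0)// mulVf// gt_eqF.
  have := Nconv _ _ _ _ (divr_gt0 a0 ab0) (divr_gt0 b0 ab0) ab1 Na Nb.
  have -> : (a / (a + b)) *: (a^-1 *: x) + (b / (a + b)) *: (b^-1 *: y) =
      (a + b)^-1 *: (x + y).
    by rewrite !scalerA scalerDr; congr (_ *: _ + _ *: _); field; rewrite !gt_eqF.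
  by rewrite NZ ?invr_ge0 ?(ltW ab0)// ler_pdivrMl// mulr1.
- exists c => // x; have [->|x0] := eqVneq x 0; first by rewrite N0 normr0 mulr0.
  by have [u /NcC /andP[cu _] ->] := NE x x0; rewrite mulrC ler_wpM2l.
- exists C => x; have [->|x0] := eqVneq x 0; first by rewrite N0 normr0 mulr0.
  by have [u /NcC /andP[_ Cu] ->] := NE x x0; rewrite mulrC ler_wpM2r.
Qed.

Lemma radial_norm_gauge (R : realType) n (h : 'rV[R]_n -> R) :
  (0 < n)%N -> support_like h -> gauge (radial_norm h).
Proof.
move=> n0 sh.
have [M M0 HM] := radial_integral_le n0 sh.
have [m m0 Hm] := radial_integral_ge sh.
have f0 : 0 < n.-1`!%:R :> R by rewrite ltr0n fact_gt0.
apply: (@gauge_of_convex_ball R n (radial_norm h)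
  ((M / n.-1`!%:R) `^ (- n%:R^-1)) ((m / n.-1`!%:R) `^ (- n%:R^-1))).
- by move=> t x; exact: radial_normZ.
- by move=> x y lam mu; exact: radial_norm_convex.
- by rewrite powR_gt0// divr_gt0.
move=> x x1; have x0 : x != 0 by rewrite -normr_eq0 x1 oner_eq0.
have [v v0 E] := radial_integral_fin n0 sh x0.
have xle1 : `|x| <= 1 by rewrite x1.
have := HM x x1; have := Hm x xle1; rewrite /radial_norm E !lee_fin => mv vM.
(* The norm decreases in the integral, so the upper bound [M] gives the lower constant of the gauge
   and [m] the upper one. *)
have anti (u w : R) : 0 < u -> u <= w -> (w / n.-1`!%:R) `^ (- n%:R^-1) <=
    (u / n.-1`!%:R) `^ (- n%:R^-1).
  move=> u0 uw; have w0 : 0 < w by exact: lt_le_trans uw.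
  rewrite !powRN lef_pV2 ?posrE ?powR_gt0 ?divr_gt0//.
  apply: ge0_ler_powR; rewrite ?invr_ge0//
    ?nnegrE ?divr_ge0 ?(ltW u0) ?(ltW w0) ?(ltW f0)//.
  by rewrite ler_pM2r ?invr_gt0.
by rewrite !anti.
Qed.

(** * L_p polar bodies *)

Lemma inner_le (R : realType) n (x y : 'rV[R]_n) : `|inner x y| <= n%:R * `|x| * `|y|.
Proof.
apply: (le_trans (ler_norm_sum _ _ _)).
apply: (@le_trans _ _ (\sum_(i < n) `|x| * `|y|)).
  by apply: ler_sum => i _; rewrite normrM ler_pM ?coord_le_norm.
by rewrite sumr_const card_ord -mulrA mulr_natl.
Qed.

Lemma convex_body_bounds (R : realType) n (K : set 'rV[R]_n) : convex_body K -> K° 0 ->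
  [/\ measurable K, exists2 r, 0 < r & forall x, `|x| <= r -> K x &
      exists2 r, 0 < r & forall x, K x -> `|x| <= r].
Proof.
move=> [cK _ _] K0; split.
- by apply: closed_measurable_rV; apply: compact_closed => //; exact: norm_hausdorff.
- have /nbhs_ballP[e /= e0 eK] : nbhs (0 : 'rV[R]_n) K by [].
  exists (e / 2); first by rewrite divr_gt0.
  move=> x xe; apply: eK; rewrite -ball_normE /ball_ /= sub0r normrN.
  by apply: le_lt_trans xe _; lra.
- have [M [Mreal HM]] := compact_bounded cK.
  exists (`|M| + 1); first by rewrite ltr_wpDl.
  move=> x Kx; apply: HM Kx; apply: le_lt_trans (ler_norm M) _.
  by rewrite ltrDl.
Qed.

Lemma convex_body_volume (R : realType) n (K : set 'rV[R]_n) : convex_body K -> K° 0 ->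
  lebesgue_rV n K \is a fin_num /\ (0 < lebesgue_rV n K)%E.
Proof.
move=> bK K0; have [mK [r r0 rK] [s s0 Ks]] := convex_body_bounds bK K0; split.
  rewrite ge0_fin_numE// (@le_lt_trans _ _ (lebesgue_rV n [set x | `|x| <= s]))//.
    exact: lebesgue_rV_mono.
  by rewrite lebesgue_rV_cube ?ltry// ltW.
apply: (@lt_le_trans _ _ (lebesgue_rV n [set x | `|x| <= r])).
  by rewrite lebesgue_rV_cube ?(ltW r0)// lte_fin exprn_gt0// mulr_gt0.
exact: lebesgue_rV_mono.
Qed.

Definition support_fun (R : realType) n (K : set 'rV[R]_n) (y : 'rV[R]_n) : R :=
  sup [set inner x y | x in K].

Lemma support_fun_gauge (R : realType) n (K : set 'rV[R]_n) : convex_body K -> K° 0 ->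
  gauge (support_fun K) /\ polar K = [set y | support_fun K y <= 1].
Proof.
move=> bK K0; have [_ [r r0 rK] [s s0 Ks]] := convex_body_bounds bK K0.
have hs y : has_sup [set inner x y | x in K].
  split; first by exists (inner 0 y), 0 => //; apply: rK; rewrite normr0 ltW.
  exists (n%:R * s * `|y|) => _ [x Kx <-]; apply: le_trans (ler_norm _) _.
  apply: le_trans (inner_le x y) _; rewrite ler_wpM2r// ler_wpM2l//; exact: Ks.
have sE x y : K x -> inner x y <= support_fun K y.
  by move=> Kx; apply: ub_le_sup; [exact: (hs y).2|exists x].
have leS y c : (forall x, K x -> inner x y <= c) -> support_fun K y <= c.
  by move=> H; apply: ge_sup => [|_ [x Kx <-]]; [exact: (hs y).1|exact: H].
have K00 : K 0 by apply: rK; rewrite normr0 ltW.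
have inner0 (y : 'rV[R]_n) : inner 0 y = 0.
  by rewrite -(scale0r (0 : 'rV[R]_n)) innerZl mul0r.
split; last first.
  apply/seteqP; split => y /=; first exact: leS.
  by move=> Hy x Kx; apply: le_trans (sE _ _ Kx) Hy.
split.
- move=> t y; rewrite le_eqVlt => /predU1P[<-|t0].
    rewrite scale0r mul0r; apply/eqP; rewrite eq_le; apply/andP; split.
      by apply: leS => x _; rewrite innerC inner0.
    by rewrite -(inner0 0); exact: sE.
  apply/eqP; rewrite eq_le; apply/andP; split.
    by apply: leS => x Kx; rewrite innerZr ler_pM2l//; exact: sE.
  rewrite -ler_pdivlMl//; apply: leS => x Kx.
  by rewrite ler_pdivlMl// -innerZr; exact: sE.
- by move=> x y; apply: leS => z Kz; rewrite innerDr lerD// sE.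
- exists r => // y; rewrite -[r]gtr0_norm// -normrZ.
  apply: norm_le_coord => [|i]; first by rewrite -(inner0 y) sE.
  (* The norm is the sup norm, so testing against the points +r and -r on each axis bounds it from
     above. *)
  have Ke t : `|t| <= r -> K (t *: delta_mx 0 i).
    move=> tr; apply: rK; rewrite normrZ; apply: le_trans tr.
    by rewrite ler_piMr// norm_delta_le.
  rewrite mxE ler_norml -inner_delta; apply/andP; split.
    by rewrite lerNl -mulNr -innerZl; apply: sE; apply: Ke; rewrite normrN gtr0_norm.
  by rewrite -innerZl; apply: sE; apply: Ke; rewrite gtr0_norm.
- exists (n%:R * s) => y; apply: leS => x Kx; apply: le_trans (ler_norm _) _.
  by apply: le_trans (inner_le x y) _; rewrite ler_wpM2r// ler_wpM2l//; exact: Ks.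
Qed.

Lemma norm_coord_attained (R : realType) n (y : 'rV[R]_n) : (0 < n)%N ->
    exists i, `|y| <= `|y 0 i|.
Proof.
move=> n0; apply: contrapT => /forallNP H.
have lt i : `|y 0 i| < `|y| by rewrite ltNge; apply/negP; exact: H.
have y0 : 0 < `|y| by apply: le_lt_trans (lt (Ordinal n0)).
by have := norm_lt_coord y0 lt; rewrite ltxx.
Qed.

Lemma measurable_dist (R : realType) n (c : 'rV[R]_n) :
    measurable_fun setT (fun x : 'rV[R]_n => `|x - c|).
Proof.
have gn : gauge (fun x : 'rV[R]_n => `|x|).
  split; [by move=> t x t0; rewrite normrZ ger0_norm|exact: ler_normD| |].
    by exists 1 => // x; rewrite mul1r.
  by exists 1 => x; rewrite mul1r.
have := measurableT_comp (measurable_gauge gn) (@measurable_affine R n 1 (- c)).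
by apply: eq_measurable_fun => x _ /=; rewrite scale1r.
Qed.

Lemma measurable_norm_ball (R : realType) n (c : 'rV[R]_n) (e : R) :
    measurable [set x | `|x - c| <= e].
Proof.
rewrite (_ : [set x | _] = (fun x : 'rV[R]_n => `|x - c|) @^-1` `]-oo, e]).
  by rewrite -[X in measurable X]setTI; apply: (measurable_dist c).
by apply/seteqP; split => x; rewrite /= in_itv.
Qed.

Lemma lebesgue_rV_ball (R : realType) n (c : 'rV[R]_n) (e : R) : 0 <= e ->
  lebesgue_rV n [set x | `|x - c| <= e] = ((2 * e) ^+ n)%:E.
Proof.
move=> e0; rewrite -lebesgue_rV_cube//.
have m0 := @measurable_dist R n.
have E (b : 'rV[R]_n) : (\int[lebesgue_rV n]_x (ind_le `|x - b| e)%:E =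
    lebesgue_rV n [set x | (`|x - b| <= e)%R])%E.
  by apply: integral_ind_le; [exact: m0|exact: measurable_cst].
have mi (b : 'rV[R]_n) : measurable_fun setT (fun x : 'rV[R]_n => (ind_le `|x - b| e)%:E).
  by apply/measurable_EFinP; apply: measurable_ind_le.
have i0 (b x : 'rV[R]_n) : (0 <= (ind_le `|x - b| e)%:E)%E by rewrite lee_fin ind_le_ge0.
have -> : [set x : 'rV[R]_n | `|x| <= e] = [set x | `|x - 0| <= e].
  by apply/seteqP; split => x /=; rewrite subr0.
rewrite -!E -(@integral_rV_affine R n 1 c _ ltr01 (mi c) (i0 c)) expr1n mul1e.
by apply: eq_integral => x _; rewrite scale1r addrK subr0.
Qed.

(** Normalising by [A] and [B] before Jensen makes this the pointwise form of Hölder: with [A] and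
    [B] the two averages, the bracket averages to lam + mu = 1. *)
Lemma weighted_young (R : realType) (lam mu A B a b : R) : 0 < lam -> 0 < mu ->
    lam + mu = 1 -> 0 < A -> 0 < B ->
  expR (lam * a + mu * b) <= gmean lam mu A B * (lam / A * expR a + mu / B * expR b).
Proof.
move=> lam0 mu0 lm A0 B0.
have -> : expR (lam * a + mu * b) = gmean lam mu A B * expR
    (lam * (a - ln A) + mu * (b - ln B)).
  by rewrite /gmean -expRD; congr expR; ring.
rewrite ler_pM2l ?gmean_gt0//.
apply: le_trans (expR_jensen _ _ (ltW lam0) (ltW mu0) lm) _.
by rewrite !expRD !expRN !lnK ?posrE// !mulrA !(mulrAC _ (expR _)).
Qed.

Definition mean_exp (R : realType) n (K : set 'rV[R]_n) (q : R) (y : 'rV[R]_n) : R :=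
  (fine (lebesgue_rV n K))^-1 * \int[lebesgue_rV n]_(x in K) expR (q * inner x y).

Section Lp_support_like.
Context {R : realType} {n : nat} (K : set 'rV[R]_n) (q : R).
Hypotheses (bK : convex_body K) (K0 : K° 0) (q0 : 0 < q).

Local Notation vol := (@lebesgue_rV R n).
Local Notation V := (fine (vol K)).
Local Notation f := (fun y x : 'rV[R]_n => expR (q * inner x y)).
Local Notation E := (mean_exp K q).

Let mK : measurable K. Proof. by case: (convex_body_bounds bK K0). Qed.

Let V0 : 0 < V.
Proof. by have [h1 h2] := convex_body_volume bK K0; rewrite fine_gt0//
  h2 /= -ge0_fin_numE. Qed.

Let iV0 : 0 < V^-1. Proof. by rewrite invr_gt0. Qed.

Let mf y : measurable_fun setT (f y).
Proof.
apply: (measurableT_comp (@measurable_expR R)); apply: measurable_funM => //.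
under eq_fun do rewrite innerC; exact: measurable_inner.
Qed.

Let Kfin : (vol K < +oo)%E.
Proof. by have [h1 h2] := convex_body_volume bK K0; rewrite -ge0_fin_numE. Qed.

Let int_f y : vol.-integrable K (EFin \o f y).
Proof.
have [_ _ [s s0 Ks]] := convex_body_bounds bK K0.
apply: measurable_bounded_integrable => //; first by apply: measurable_funTS; exact: mf.
exists (expR (q * (n%:R * s * `|y|))); split; first by rewrite num_real.
move=> M hM x /= Kx; rewrite ger0_norm ?expR_ge0//
  (le_trans _ (ltW hM))// ler_expR ler_pM2l//.
apply: le_trans (ler_norm _) _; apply: le_trans (inner_le x y) _.
by rewrite ler_wpM2r// ler_wpM2l//; exact: Ks.
Qed.

Let int_cst (c : R) : vol.-integrable K (EFin \o cst c).
Proof.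
apply: measurable_bounded_integrable => //; exists `|c|; split; first by rewrite num_real.
by move=> M hM x _ /=; exact: ltW.
Qed.

Let avg_cst (c : R) : V^-1 * \int[vol]_(x in K) (cst c) x = c.
Proof. by rewrite Rintegral_cst// mulrCA mulVf ?mulr1// gt_eqF. Qed.

Let E_gt0 y : 0 < E y.
Proof.
have [_ _ [s s0 Ks]] := convex_body_bounds bK K0.
apply: (@lt_le_trans _ _ (expR (- (q * (n%:R * s * `|y|))))); first exact: expR_gt0.
rewrite -[leLHS]avg_cst /mean_exp (ler_pM2l iV0); apply: le_Rintegral => // x Kx.
rewrite /= ler_expR -mulrN ler_pM2l// lerNl; apply:
  le_trans (ler_norm _) _; rewrite normrN.
apply: le_trans (inner_le x y) _.
by rewrite ler_wpM2r// ler_wpM2l//; exact: Ks.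
Qed.

(** Hölder's inequality, by integrating [weighted_young] with A = E x and B = E y. *)
Let ln_E_convex x y lam mu : 0 < lam -> 0 < mu -> lam + mu = 1 ->
  ln (E (lam *: x + mu *: y)) <= lam * ln (E x) + mu * ln (E y).
Proof.
move=> lam0 mu0 lm.
rewrite -ler_expR lnK ?posrE// -/(gmean lam mu (E x) (E y)).
set c := gmean _ _ _ _; have c0 : 0 < c by exact: gmean_gt0.
have key z : f (lam *: x + mu *: y) z <= c * (lam / E x) * f x z + c * (mu / E y) * f y z.
  have := weighted_young (q * inner z x) (q * inner z y) lam0 mu0 lm (E_gt0 x) (E_gt0 y).
  rewrite mulrDr -/c !mulrA; congr (expR _ <= _).
  by rewrite innerDr !innerZr mulrDr !(mulrCA q) !mulrA.
have int_Z w t : vol.-integrable K (EFin \o (fun z => t * f w z)).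
  by apply: (integrableZl mK t (int_f w)).
have RE w : \int[vol]_(z in K) f w z = V * E w by rewrite /mean_exp mulVKf// gt_eqF.
apply: (@le_trans _ _ (V^-1 * \int[vol]_(z in K) (c * (lam / E x) * f x z +
  c * (mu / E y) * f y z))).
  rewrite {1}/mean_exp (ler_pM2l iV0); apply: le_Rintegral => //.
  exact: (integrableD mK (int_Z _ _) (int_Z _ _)).
rewrite (RintegralD mK (int_Z _ _) (int_Z _ _)) !(RintegralZl _ mK (int_f _)) !RE.
move: (E x) (E y) (E_gt0 x) (E_gt0 y) V V0 => a b a0 b0 v v0.
have -> : v^-1 * (c * (lam / a) * (v * a) + c * (mu / b) * (v * b)) = c * (lam + mu).
  by field; rewrite !gt_eqF.
by rewrite lm mulr1.
Qed.

Let ln_E_lipschitz : exists2 C, 0 < C & forall x y, ln (E y) <=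
    ln (E x) + q * (C * `|y - x|).
Proof.
have [_ _ [s s0 Ks]] := convex_body_bounds bK K0.
exists (n%:R * s + 1); first by rewrite ltr_wpDl ?mulr_ge0// ltW.
move=> x y; set c := q * _.
have lnE w : expR (ln (E w)) = E w by rewrite lnK ?posrE.
rewrite -ler_expR expRD !lnE /mean_exp -[leRHS]mulrA (ler_pM2l iV0) [leRHS]mulrC
  -(RintegralZl _ mK (int_f _)).
apply: le_Rintegral => //; first exact: (integrableZl mK (expR c) (int_f x)).
move=> z Kz; rewrite -expRD ler_expR.
have -> : y = x + (y - x) by rewrite addrC subrK.
rewrite innerDr mulrDr addrC lerD2r /c ler_pM2l//.
apply: le_trans (ler_norm _) _; apply: le_trans (inner_le z _) _.
apply: ler_wpM2r => //; apply: (@le_trans _ _ (n%:R * s)); last by rewrite lerDl.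
by rewrite ler_wpM2l//; exact: Ks.
Qed.

Let E0 : E 0 = 1.
Proof.
rewrite /mean_exp -[RHS]avg_cst; congr (_ * _); apply: eq_Rintegral => x _.
by rewrite innerC -(scale0r (0 : 'rV[R]_n)) innerZl mul0r mulr0 expR0.
Qed.

(** The integral over [K] is at least that over one small cube, placed along the coordinate where
    [y] attains its sup norm. *)
Let E_coercive : (0 < n)%N -> exists d m,
    [/\ 0 < d, 0 < m & forall y, m * expR (q * (d * `|y|)) <= E y].
Proof.
move=> n0; have [_ [r r0 rK] _] := convex_body_bounds bK K0.
have nR0 : 0 < n%:R :> R by rewrite ltr0n.
(* Within the cube, [inner _ y] moves by at most n e |y| = (r / 4) |y|, half of its value at the
   centre; and e + r / 2 <= r keeps the cube in [K]. *)
pose e := r / (4 * n%:R).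
have e0 : 0 < e by rewrite divr_gt0// mulr_gt0.
have er : n%:R * e = r / 4 by rewrite /e; field; rewrite gt_eqF.
have er' : e <= r / 4.
  rewrite -er -[leLHS]mul1r ler_pM2r// (_ : 1 = 1%:R)// ler_nat//.
exists (r / 4), (V^-1 * (2 * e) ^+ n); split.
- by rewrite divr_gt0.
- by rewrite mulr_gt0 ?invr_gt0// exprn_gt0// mulr_gt0.
move=> y; have [i yi] := norm_coord_attained y n0.
(* On the cube of radius [e] around [c], [inner _ y >= (r / 4) |y|]. *)
pose c : 'rV[R]_n := (r / 2 * Num.sg (y 0 i)) *: delta_mx 0 i.
have nc : `|c| <= r / 2.
  rewrite /c normrZ normrM (ger0_norm (_ : 0 <= r / 2)) ?divr_ge0 ?(ltW r0)//.
  rewrite -mulrA ler_piMr ?divr_ge0 ?(ltW r0)// mulr_ile1 ?norm_delta_le// normr_sg.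
  by case: (_ != 0).
pose B := [set x : 'rV[R]_n | `|x - c| <= e].
have BK : B `<=` K.
  move=> x; rewrite /B /= => xc; apply: rK.
  have -> : x = (x - c) + c by rewrite subrK.
  by apply: le_trans (ler_normD _ _) _; lra.
have Bin x : B x -> r / 4 * `|y| <= inner x y.
  rewrite /B /= => xc; have -> : x = (x - c) + c by rewrite subrK.
  rewrite innerDl.
  have h1 : inner c y = r / 2 * `|y 0 i|.
    by rewrite /c innerZl inner_delta normrEsg mulrA.
  have h2 : - (r / 4 * `|y|) <= inner (x - c) y.
    rewrite lerNl; apply: le_trans (ler_norm _) _; rewrite normrN.
    apply: le_trans (inner_le _ _) _; rewrite ler_wpM2r// -er ler_wpM2l//.
  have h3 : r / 2 * `|y| <= r / 2 * `|y 0 i| by rewrite ler_wpM2l// divr_ge0// ltW.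
  rewrite h1; have : r / 2 * `|y| = r / 4 * `|y| + r / 4 * `|y| by lra.
  lra.
rewrite /mean_exp -[leLHS]mulrA (ler_pM2l iV0).
rewrite -lee_fin /Rintegral fineK; last exact: (integrable_fin_num mK (int_f y)).
have mB : measurable B := measurable_norm_ball c e.
have volB : vol B = ((2 * e) ^+ n)%:E by exact: (lebesgue_rV_ball c (ltW e0)).
apply: (@le_trans _ _ (\int[vol]_(x in B) (cst (expR (q * (r / 4 * `|y|)))%:E x))%E).
  rewrite (integral_cst _ mB) [X in (_ * X)%E](_ : _ = ((2 * e) ^+ n)%:E);
    last exact: volB.
  by rewrite -EFinM mulrC.
apply: (@le_trans _ _ (\int[vol]_(x in B) (f y x)%:E)%E).
  apply: ge0_le_integral => //.
  - by move=> x _; rewrite lee_fin expR_ge0.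
  - by apply: measurable_funTS; apply/measurable_EFinP; exact: mf.
  - by move=> x Bx; rewrite lee_fin ler_expR ler_pM2l//; exact: Bin.
apply: ge0_subset_integral => //.
by apply: measurable_funTS; apply/measurable_EFinP; exact: mf.
Qed.

Lemma Lp_support_like : (0 < n)%N -> support_like (Lp_support q%:E K).
Proof.
move=> n0; have hE y : Lp_support q%:E K y = q^-1 * ln (E y) by [].
split.
- move=> x y lam mu lam0 mu0 lm; rewrite !hE !(mulrCA _ q^-1) -mulrDr
  ler_pM2l ?invr_gt0//.
  exact: ln_E_convex.
- have [C C0 HC] := ln_E_lipschitz; exists C => // x y.
  by rewrite !hE -(ler_pM2l q0) mulrDr !mulVKf ?gt_eqF.
- by rewrite hE E0 ln1 mulr0.
- have [d [m [d0 m0 Hm]]] := E_coercive n0.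
  exists d, (- (q^-1 * ln m)); split => // y; rewrite hE -(ler_pM2l q0) mulVKf ?gt_eqF//.
  rewrite opprK mulrDr mulVKf ?gt_eqF// -ler_expR lnK ?posrE// expRD lnK ?posrE// mulrC.
  exact: Hm.
Qed.

End Lp_support_like.
Lemma Lp_polar_gauge (R : realType) n (p : \bar R) (K : set 'rV[R]_n) :
  (0 < n)%N -> (0 < p)%E -> convex_body K -> K° 0 ->
  exists2 N, gauge N & Lp_polar p K = [set y | N y <= 1].
Proof.
move=> n0; case: p => [q| |]; last by rewrite ltNge leNye.
  rewrite lte_fin => q0 bK K0; exists (radial_norm (Lp_support q%:E K)); last by [].
  by apply: radial_norm_gauge => //; exact: Lp_support_like.
move=> _ bK K0; have [gN KE] := support_fun_gauge bK K0.
by exists (support_fun K) => //; rewrite /Lp_polar eqxx.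
Qed.

Theorem theorem1p4 (R : realType) (n : nat) (hn : (0 < n)%N)
    (p : \bar R) (hp : (0 < p)%E) (K L : set 'rV[R]_n)
    (hK : convex_body K) (hL : convex_body L)
    (hK0 : K° 0) (hL0 : L° 0)
    (hbar : barycenter (Lp_polar p K) = - barycenter (Lp_polar p L)) :
  ('C(2 * n, n)%:R%:E
    * lebesgue_rV n (convex_hull (Lp_polar p K `|` Lp_polar p L))
    * lebesgue_rV n
        (polar (minkowski_sub (polar (Lp_polar p K)) (polar (Lp_polar p L))))
   >= lebesgue_rV n (Lp_polar p K) * lebesgue_rV n (Lp_polar p L))%E.
Proof.
have [N gN KE] := Lp_polar_gauge hn hp hK hK0.
have [M gM LE] := Lp_polar_gauge hn hp hL hL0.
by move: hbar; rewrite KE LE; exact: gauge_inequality.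
Qed.
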